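(* Let $p\in(2,3)$, let $(\mathcal{P}^n)_{n\in\mathbb{N}}$ be a sequence of partitions $\mathcal{P}^n=\{0=t^n_0<t^n_1<\cdots<t^n_{N_n}=T\}$ of $[0,T]$ with vanishing mesh size, and suppose that $S\in C([0,T];\mathbb{R}^d)$ satisfies Property (RIE) with respect to $p$ and $(\mathcal{P}^n)_{n\in\mathbb{N}}$. Let $q\geq p$ be such that $2/p+1/q>1$. Let $f\in C^{p+\varepsilon}(\mathbb{R}^d;\mathbb{R}^d)$ for some $\varepsilon>0$, so that in particular $(f(S),\mathrm{D}f(S))\in\mathcal{V}^q_S$. Then, for any $(Y,Y')\in\mathcal{V}^q_S$, the integral of the controlled path $(Y,Y')$ against the controlled path $(f(S),\mathrm{D}f(S))$ (with respect to the rough path $\mathbf{S}=(S,\mathbb{S})$ associated to $S$) is given by $$\int_0^t Y_u\,\mathrm{d}f(S)_u=\lim_{n\to\infty}\sum_{k=0}^{N_n-1}Y_{t^n_k}\, f(S)_{t^n_k\wedge t,\,t^n_{k+1}\wedge t},$$ where the convergence is uniform in $t\in[0,T]$.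
   Context: Notation: $\Delta_{[0,T]}=\{(s,t)\in[0,T]^2:s\le t\}$; for a path $S$, $S_{s,t}:=S_t-S_s$. For a path or a two-parameter function $A$ on $\Delta_{[0,T]}$ and $a\ge1$, $\|A\|_{a,[s,t]}:=\sup_{\mathcal{P}}(\sum_{[u,v]\in\mathcal{P}}|A_{u,v}|^a)^{1/a}$, the supremum being over finite partitions of $[s,t]$, and $\|A\|_a:=\|A\|_{a,[0,T]}$. A control function is a map $c\colon\Delta_{[0,T]}\to[0,\infty)$ with $c(s,u)+c(u,t)\le c(s,t)$ for $s\le u\le t$. $C^{k+\gamma}$, $k\in\mathbb{N}$, $\gamma\in(0,1]$, is the class of $k$-times continuously differentiable functions whose $k$-th derivative is locally $\gamma$-Hölder continuous. Products of vectors $Y_sG_{s,t}$ are Euclidean inner products. Convention: $0/0:=0$. Property (RIE): with $S^n_t:=S_T\mathbf{1}_{\{T\}}(t)+\sum_{k=0}^{N_n-1}S_{t^n_k}\mathbf{1}_{[t^n_k,t^n_{k+1})}(t)$, (1) the Riemann sums $\int_0^tS^n_u\otimes\mathrm{d}S_u:=\sum_{k=0}^{N_n-1}S_{t^n_k}\otimes S_{t^n_k\wedge t,t^n_{k+1}\wedge t}$ converge uniformly in $t\in[0,T]$ as $n\to\infty$ to a limit denoted $\int_0^tS_u\otimes\mathrm{d}S_u$; and (2) there is a control function $c$ such that $$\sup_{(s,t)\in\Delta_{[0,T]}}\frac{|S_{s,t}|^p}{c(s,t)}+\sup_{n\in\mathbb{N}}\ \sup_{0\le k<\ell\le N_n}\frac{\big|\int_{t^n_k}^{t^n_\ell}S^n_u\otimes\mathrm{d}S_u-S_{t^n_k}\otimes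 S_{t^n_k,t^n_\ell}\big|^{p/2}}{c(t^n_k,t^n_\ell)}\le1.$$ In this case $\mathbf{S}=(S,\mathbb{S})$ with $\mathbb{S}_{s,t}:=\int_s^tS_u\otimes\mathrm{d}S_u-S_s\otimes S_{s,t}$ is a $p$-rough path (i.e. $S$, $\mathbb{S}$ are continuous, $\|S\|_p<\infty$, $\|\mathbb{S}\|_{p/2}<\infty$, and $\mathbb{S}_{s,t}=\mathbb{S}_{s,u}+\mathbb{S}_{u,t}+S_{s,u}\otimes S_{u,t}$); this is the associated rough path. Controlled paths: let $r>1$ with $1/r=1/p+1/q$. $\mathcal{V}^q_S=\mathcal{V}^q_S([0,T];\mathbb{R}^d)$ is the set of pairs $(F,F')$ of continuous paths $F\colon[0,T]\to\mathbb{R}^d$, $F'\colon[0,T]\to\mathcal{L}(\mathbb{R}^d;\mathbb{R}^d)$ such that $\|F'\|_q<\infty$ and the remainder $R^F_{s,t}:=F_{s,t}-F'_sS_{s,t}$ satisfies $\|R^F\|_r<\infty$. Integral of controlled paths: for $(F,F'),(G,G')\in\mathcal{V}^q_S$, $\int_0^tF_u\,\mathrm{d}G_u:=\lim_{|\mathcal{P}|\to0}\sum_{[s,v]\in\mathcal{P}}\big(F_sG_{s,v}+F'_sG'_s\mathbb{S}_{s,v}\big)$, over partitions $\mathcal{P}$ of $[0,t]$, where $F'_sG'_s\mathbb{S}_{s,v}:=\sum_{i,j,k}(F'_s)^{ij}(G'_s)^{ik}\mathbb{S}^{jk}_{s,v}$; the limit exists along every sequence of partitions with mesh tending to zero. 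*)

(* Defs.v *)
From HB Require Import structures.
From mathcomp Require Import all_boot all_order all_algebra.
From mathcomp Require Import all_classical all_reals all_analysis.
Set Implicit Arguments.
Unset Strict Implicit.
Unset Printing Implicit Defensive.
Import Order.TTheory GRing.Theory Num.Theory.
Import numFieldNormedType.Exports.
Local Open Scope classical_set_scope.
Local Open Scope ring_scope.

(* Vectors of R^d are row vectors ['rV_d].  A linear map L(R^d; R^m) is stored
   with its usual indices, [A i j] being output i and input j, so that its value
   at the row vector v is [v *m A^T].  Paths are total functions on R of which
   only the restriction to [0, T] is ever used. *)

(* Euclidean (Frobenius) norm; the norm [`|A|] of the library is the maximum
   norm. *)
Definition enorm (R : realType) (m n : nat) (A : 'M[R]_(m, n)) : R :=
  Num.sqrt (\sum_i \sum_j A i j ^+ 2).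

Definition dotp (R : realType) (d : nat) (u v : 'rV[R]_d) : R :=
  \sum_i u 0 i * v 0 i.

Definition tensor (R : realType) (d : nat) (u v : 'rV[R]_d) : 'M[R]_d :=
  u^T *m v.

Definition incr (R : realType) (V : zmodType) (X : R -> V) (s t : R) : V :=
  X t - X s.

(* A partition s = t_0 < t_1 < ... < t_N = t is the list P = [t_1; ...; t_N]
   with [itv_partition s t P]; then N = size P and t_k = pt s P k. *)
Definition pt (R : realType) (s : R) (P : seq R) (k : nat) : R :=
  nth s (s :: P) k.

Definition mesh (R : realType) (s : R) (P : seq R) : R :=
  \big[Num.max/0]_(k < size P) (pt s P k.+1 - pt s P k).

(* The filter |P| -> 0 on partitions of [s, t]. *)
Definition mesh_filter (R : realType) (s t : R) : set_system (seq R) :=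
  filter_from [set delta : R | 0 < delta]
    (fun delta => [set P | itv_partition s t P /\ mesh s P < delta]).

Global Instance mesh_filter_filter (R : realType) (s t : R) :
  Filter (mesh_filter s t).
Proof.
apply: filter_from_filter; first by exists 1; rewrite /= ltr01.
move=> a b /= a0 b0; exists (Num.min a b); first by rewrite /= lt_min a0 b0.
by move=> P [stP]; rewrite lt_min => /andP[Pa Pb].
Qed.

Definition pvar (R : realType) (m n : nat) (a : R)
    (A : R -> R -> 'M[R]_(m, n)) (s t : R) : \bar R :=
  ereal_sup [set ((\sum_(k < size P) enorm (A (pt s P k) (pt s P k.+1)) `^ a)
                  `^ a^-1)%:E | P in itv_partition s t].

Definition control (R : realType) (T : R) (c : R -> R -> R) : Prop :=
  (forall s t, 0 <= s -> s <= t -> t <= T -> 0 <= c s t) /\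
  (forall s u t, 0 <= s -> s <= u -> u <= t -> t <= T ->
     c s u + c u t <= c s t).

Definition locally_holder (R : realType) (d m : nat) (gamma : R)
    (g : 'rV[R]_d -> 'rV[R]_m) : Prop :=
  forall x : 'rV[R]_d, exists L : R, \forall y & z \near x,
    enorm (g y - g z) <= L * enorm (y - z) `^ gamma.

(* [holder_Ck k gamma g]: g is k times (Frechet) differentiable and its k-th
   derivative, flattened to a vector by [mxvec], is locally gamma-Holder, hence
   continuous when gamma > 0. *)
Fixpoint holder_Ck (R : realType) (d : nat) (k : nat) (gamma : R) (m : nat)
    (g : 'rV[R]_d -> 'rV[R]_m) {struct k} : Prop :=
  match k with
  | 0%N => locally_holder gamma g
  | k'.+1 => (forall x, differentiable g x) /\
             holder_Ck k' gamma (fun x => mxvec (jacobian g x))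
  end.

(* The class C^a for a = k + gamma, k a natural number, gamma in (0, 1]. *)
Definition class_C (R : realType) (d m : nat) (a : R)
    (g : 'rV[R]_d -> 'rV[R]_m) : Prop :=
  exists k gamma, [/\ 0 < gamma, gamma <= 1, a = k%:R + gamma &
                      holder_Ck k gamma g].

(* [jacobian g x i j] is the i-th partial derivative of the j-th component. *)
Definition Dmx (R : realType) (d m : nat) (g : 'rV[R]_d -> 'rV[R]_m)
    (x : 'rV[R]_d) : 'M[R]_(m, d) := (jacobian g x)^T.

(* Riemann sums \int_0^t S^n_u (x) dS_u along the n-th partition of [0, T]. *)
Definition RIE_sum (R : realType) (d : nat) (P : nat -> seq R)
    (S : R -> 'rV[R]_d) (n : nat) (t : R) : 'M[R]_d :=
  \sum_(k < size (P n))
    tensor (S (pt 0 (P n) k))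
      (incr S (Num.min (pt 0 (P n) k) t) (Num.min (pt 0 (P n) k.+1) t)).

(* In [\bar R], x / 0 = +oo for x > 0 and 0 / 0 = 0. *)
Definition equot (R : realType) (x y : R) : \bar R := (x%:E / y%:E)%E.

Definition RIE_path_bound (R : realType) (d : nat) (T p : R)
    (S : R -> 'rV[R]_d) (c : R -> R -> R) : \bar R :=
  ereal_sup [set equot (enorm (incr S st.1 st.2) `^ p) (c st.1 st.2)
            | st in [set st : R * R |
                     [/\ 0 <= st.1, st.1 <= st.2 & st.2 <= T]]].

Definition RIE_area_bound (R : realType) (d : nat) (p : R) (P : nat -> seq R)
    (S : R -> 'rV[R]_d) (c : R -> R -> R) : \bar R :=
  ereal_sup [set ereal_sup
    [set let s := pt 0 (P n) kl.1 in let t := pt 0 (P n) kl.2 in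
         equot (enorm (incr (RIE_sum P S n) s t
                       - tensor (S s) (incr S s t)) `^ (p / 2)) (c s t)
    | kl in [set kl : nat * nat | (kl.1 < kl.2)%N /\ (kl.2 <= size (P n))%N]]
    | n in [set: nat]].

Definition RIE (R : realType) (d : nat) (T p : R) (P : nat -> seq R)
    (S : R -> 'rV[R]_d) : Prop :=
  (exists I : R -> 'M[R]_d,
     {uniform `[0, T], RIE_sum P S n @[n --> \oo] --> I}) /\
  (exists c : R -> R -> R, control T c /\
     (RIE_path_bound T p S c + RIE_area_bound p P S c <= 1)%E).

Definition RIE_integral (R : realType) (d : nat) (P : nat -> seq R)
    (S : R -> 'rV[R]_d) (t : R) : 'M[R]_d :=
  lim (RIE_sum P S n t @[n --> \oo]).

(* The second level of the rough path associated to S. *)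
Definition RIE_area (R : realType) (d : nat) (P : nat -> seq R)
    (S : R -> 'rV[R]_d) (s t : R) : 'M[R]_d :=
  incr (RIE_integral P S) s t - tensor (S s) (incr S s t).

Definition remainder (R : realType) (d : nat) (S F : R -> 'rV[R]_d)
    (F' : R -> 'M[R]_d) (s t : R) : 'rV[R]_d :=
  incr F s t - incr S s t *m (F' s)^T.

Definition controlled (R : realType) (d : nat) (T p q : R)
    (S : R -> 'rV[R]_d) (F : R -> 'rV[R]_d) (F' : R -> 'M[R]_d) : Prop :=
  let r := (p^-1 + q^-1)^-1 in
  [/\ {within `[0, T], continuous F},
      {within `[0, T], continuous F'},
      (pvar q (incr F') 0 T < +oo)%E &
      (pvar r (remainder S F F') 0 T < +oo)%E].

Definition contract (R : realType) (d : nat) (A B M : 'M[R]_d) : R :=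
  \sum_i \sum_j \sum_k A i j * B i k * M j k.

Definition compensated_sum (R : realType) (d : nat) (SS : R -> R -> 'M[R]_d)
    (F : R -> 'rV[R]_d) (F' : R -> 'M[R]_d)
    (G : R -> 'rV[R]_d) (G' : R -> 'M[R]_d) (P : seq R) : R :=
  \sum_(k < size P)
    let s := pt 0 P k in let v := pt 0 P k.+1 in
    (dotp (F s) (incr G s v) + contract (F' s) (G' s) (SS s v)).

Definition rough_integrable (R : realType) (d : nat) (SS : R -> R -> 'M[R]_d)
    (F : R -> 'rV[R]_d) (F' : R -> 'M[R]_d)
    (G : R -> 'rV[R]_d) (G' : R -> 'M[R]_d) (t : R) : Prop :=
  cvg (compensated_sum SS F F' G G' P @[P --> mesh_filter 0 t]).

Definition rough_integral (R : realType) (d : nat) (SS : R -> R -> 'M[R]_d)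
    (F : R -> 'rV[R]_d) (F' : R -> 'M[R]_d)
    (G : R -> 'rV[R]_d) (G' : R -> 'M[R]_d) (t : R) : R :=
  lim (compensated_sum SS F F' G G' P @[P --> mesh_filter 0 t]).

(* Main.v *)
Require Import Defs.
From HB Require Import structures.
From mathcomp Require Import all_boot all_order all_algebra.
From mathcomp Require Import all_classical all_reals all_analysis.
From mathcomp Require Import ring lra.
Set Implicit Arguments.
Unset Strict Implicit.
Unset Printing Implicit Defensive.
Import Order.TTheory GRing.Theory Num.Theory.
Import numFieldNormedType.Exports.
Local Open Scope classical_set_scope.
Local Open Scope ring_scope.

(** The compensated germ [Y_s . f(S)_(s,t) + Y'_s Df(S_s) SS_(s,t)] is almost
    additive.  Its defect on [s <= u <= t] is a sum of products of an
    increment of [S], [f(S)] or [SS] with increments of [Y'] and [Df(S)] or with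
    remainders ([germ_defectE]), hence it is of order
    [w(s, t) ^ (2 / p + 1 / q)] for a control [w] that dominates all the
    variations involved ([common_control]), and the exponent exceeds 1.  A
    control may jump, so smallness on fine partitions is obtained by
    interpolating with the uniform continuity of [S] and [SS] ([interpolate],
    [rough_path_small]): giving up a fraction [kap] of the exponent [2 / p]
    leaves the exponent [2 alpha + beta > 1] and gains an arbitrarily small
    factor.  A sewing argument then shows that compensated sums over fine
    partitions of [0, t] are close to each other at a rate that does not depend
    on [t] ([psum_lim_uniform]), so that the rough integral exists and is the
    uniform limit of the compensated sums along the given partitions.

    It remains to see that the second order terms
    [sum_k Y'_(t_k) Df(S_(t_k)) SS_(t_k, t_(k+1))] along the n-th partition tend
    to zero uniformly, although their termwise bounds of order [w ^ (2 / p)] need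
    not have a small sum, as [2 / p < 1].  Property (RIE) is made for this: on a cell of the n-th partition [SS] is the increment of the
    path [D^n = int S dS - int S^n dS] ([RIE_area_cell]), which tends to zero
    uniformly and, between partition points, is controlled by [w ^ (2 / p)]
    uniformly in [n].  So the sum is a discrete Young integral of [Y' Df(S)]
    against [D^n], and the same sewing estimate bounds it by a power of the
    supremum norm of [D^n] ([young_sum_le], [discretisation_error_le]).

    The bound by the control is postulated for the discretised areas at
    partition points only; it extends to [SS] at all times because an interval
    contains points of every fine partition close to its ends and controls grow
    with the interval ([RIE_area_le]).  The
    regularity of [f] enters through first and second order Taylor estimates on
    a ball that contains the path ([C2_on_ball]). *)

(* Disambiguates from the contraction of the extended reals. *)
Local Notation contract := Defs.contract.

(** * Real powers and interpolation *)

Section Powers.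
Context {R : realType}.
Implicit Types x y a b : R.

Lemma ler_powR_nneg x y a : 0 <= a -> 0 <= x -> x <= y -> x `^ a <= y `^ a.
Proof.
by move=> a0 x0 xy; apply: ge0_ler_powR => //; rewrite nnegrE// (le_trans x0).
Qed.

Lemma powR_exp_lower x W a b : 0 <= x -> x <= W -> 0 < b -> b <= a ->
  x `^ a <= W `^ (a - b) * x `^ b.
Proof.
move=> x0 xW b0 ba.
have a0 : 0 < a by exact: lt_le_trans ba.
have -> : x `^ a = x `^ (a - b) * x `^ b.
  by rewrite -powRD ?subrK ?(gt_eqF a0).
by rewrite ler_wpM2r ?powR_ge0// ler_powR_nneg// subr_ge0.
Qed.

Lemma powR_root_le x y a : 0 < a -> 0 <= x -> x `^ a <= y -> x <= y `^ a^-1.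
Proof.
move=> a0 x0 xy; have ia0 : 0 <= a^-1 by rewrite invr_ge0 ltW.
have := ler_powR_nneg ia0 (powR_ge0 x a) xy.
by rewrite -powRrM divff ?gt_eqF// powRr1.
Qed.

(** Use one bound for each factor of [x = x ^ kap * x ^ (1 - kap)].  This trades
    exponent for smallness: a control may jump, so that a bound by a control
    alone need not become small on short intervals. *)
Lemma interpolate x eta w a kap : 0 < a -> 0 < kap -> kap < 1 ->
  0 <= x -> x <= eta -> x <= w `^ a ->
  x <= eta `^ kap * w `^ ((1 - kap) * a).
Proof.
move=> a0 k0 k1 x0 xe xw.
have k1' : 0 < 1 - kap by rewrite subr_gt0.
have xE : x `^ kap * x `^ (1 - kap) = x.
  rewrite -(@powRD _ x kap (1 - kap)); first by rewrite subrKC powRr1.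
  by rewrite subrKC oner_eq0.
rewrite -xE; apply: ler_pM; rewrite ?powR_ge0//.
  by apply: ler_powR_nneg => //; exact: ltW.
rewrite [X in w `^ X]mulrC powRrM.
by apply: ler_powR_nneg => //; exact: ltW.
Qed.

End Powers.

(** * Sums over partitions, mesh and refinement *)

Section Partitions.
Context {R : realType}.
Implicit Types (Xi : R -> R -> R) (s t x : R) (P Q : seq R).

Definition psum Xi s P : R :=
  \sum_(k < size P) Xi (pt s P k) (pt s P k.+1).

Lemma pt_cons s x P k : (k <= size P)%N -> pt s (x :: P) k.+1 = pt x P k.
Proof. by move=> kP; rewrite /pt /=; apply: set_nth_default. Qed.

Lemma pt0 s P : pt s P 0 = s. Proof. by []. Qed.

Lemma pt_size s t P : itv_partition s t P -> pt s P (size P) = t.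
Proof. exact: itv_partition_nth_size. Qed.

Lemma pt_ltn s t P i j : itv_partition s t P -> (i < j)%N ->
  (j <= size P)%N -> pt s P i < pt s P j.
Proof.
move=> [pP _] ij jP; rewrite /pt.
have := @sorted_ltn_nth _ <%R lt_trans s (s :: P) pP i j.
by apply => //; rewrite inE /= ltnS // (leq_trans (ltnW ij)).
Qed.

Lemma pt_leq s t P i j : itv_partition s t P -> (i <= j)%N ->
  (j <= size P)%N -> pt s P i <= pt s P j.
Proof.
move=> sP; rewrite leq_eqVlt => /predU1P[->//|ij] jP.
exact/ltW/(pt_ltn sP).
Qed.

Lemma pt_bounds s t P i : itv_partition s t P -> (i <= size P)%N ->
  s <= pt s P i /\ pt s P i <= t.
Proof.
move=> sP iP; split; first by rewrite -[leLHS](pt0 s P); exact: (pt_leq sP).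
by rewrite -(pt_size sP); exact: (pt_leq sP).
Qed.

Lemma psum_nil Xi s : psum Xi s [::] = 0.
Proof. by rewrite /psum big_ord0. Qed.

Lemma psum_cons Xi s x P : psum Xi s (x :: P) = Xi s x + psum Xi x P.
Proof.
rewrite /psum /= big_ord_recl /=; congr (_ + _).
by apply: eq_bigr => i _; rewrite !pt_cons// ltnW.
Qed.

Lemma psum_cat Xi s P Q :
  psum Xi s (P ++ Q) = psum Xi s P + psum Xi (last s P) Q.
Proof.
elim: P s => [|x P IH] s /=; first by rewrite psum_nil add0r.
by rewrite !psum_cons IH addrA.
Qed.

Lemma mesh_cons s x P : mesh s (x :: P) = Num.max (x - s) (mesh x P).
Proof.
rewrite /mesh /= big_ord_recl /=; congr Num.max.
by apply: eq_bigr => i _; rewrite !pt_cons// ltnW.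
Qed.

Lemma mesh_ge0 s P : 0 <= mesh s P.
Proof. exact: bigmax_ge_id. Qed.

Lemma mesh_step s P k : (k < size P)%N -> pt s P k.+1 - pt s P k <= mesh s P.
Proof.
by move=> kP; rewrite /mesh (bigmax_sup (Ordinal kP)).
Qed.

Lemma mesh_le s P e : 0 <= e ->
  (forall k, (k < size P)%N -> pt s P k.+1 - pt s P k <= e) -> mesh s P <= e.
Proof. by move=> e0 H; apply: bigmax_le => // i _; exact: H. Qed.

Lemma itv_partition_cons_lt s t x P : itv_partition s t (x :: P) -> s < x.
Proof. by move=> [/= /andP[]]. Qed.

Lemma exists_fine_partition s t e : s <= t -> 0 < e ->
  exists P, itv_partition s t P /\ mesh s P <= e.
Proof.
move=> st e0.
have [n] : exists n : nat, (t - s) / e <= n%:R.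
  by exists (Num.truncn ((t - s) / e)).+1; apply/ltW; rewrite truncnS_gt.
rewrite ler_pdivrMr//.
elim: n s st => [|n IH] s st; rewrite ?mul0r.
  move=> ts; have -> : s = t by lra.
  by exists [::]; split; [split => /=|rewrite /mesh big_ord0 ltW].
rewrite -natr1 mulrDl mul1r => tsn.
have [ts|ts] := leP (t - s) e.
  move: st; rewrite le_eqVlt => /predU1P[->|st].
    by exists [::]; split; [split => /=|rewrite /mesh big_ord0 ltW].
  exists [:: t]; split; first exact: itv_partition1.
  by rewrite mesh_cons ge_max ts /mesh big_ord0 ltW.
have [||P [[pP lP] mP]] := IH (s + e); [lra|lra|].
exists (s + e :: P); split; first by split => //=; rewrite ltrDl e0.
by rewrite mesh_cons ge_max mP andbT; lra.
Qed.

(** The refinement is the sorted union of the points of [P] and [Q]. *)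
Lemma common_refinement s t P Q : itv_partition s t P -> itv_partition s t Q ->
  exists Z, [/\ itv_partition s t Z, {subset P <= Z} & {subset Q <= Z}].
Proof.
move=> sP sQ; set Z := sort <=%R (undup (P ++ Q)).
have memZ x : (x \in Z) = (x \in P) || (x \in Q).
  by rewrite mem_sort mem_undup mem_cat.
exists Z; split; last 2 first.
- by move=> x xP; rewrite memZ xP.
- by move=> x xQ; rewrite memZ xQ orbT.
have in_st L x : itv_partition s t L -> x \in L -> s < x /\ x <= t.
  move=> sL xL; have [k kL <-] : exists2 k, (k < size L)%N & pt s L k.+1 = x.
    by exists (index x L); rewrite ?index_mem// /pt /= nth_index.
  by split; [rewrite -[ltLHS](pt0 s L); exact: (pt_ltn sL)|case: (pt_bounds sL kL)].
have Zst x : x \in Z -> s < x /\ x <= t by rewrite memZ => /orP[]; exact: in_st.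
have sZ : path <%R s Z.
  rewrite lt_path_sortedE; apply/andP; split.
    by apply/allP => x /Zst[].
  by rewrite sort_lt_sorted undup_uniq.
split => //.
have [tP|P0] := boolP (t \in s :: P); last first.
  by case: sP => _ /eqP tl; move: P0; rewrite -{1}tl mem_last.
have [st|st] : s = t \/ s < t.
- by have := itv_partition_le sP; rewrite le_eqVlt => /predU1P[|]; auto.
- subst t; have := itv_partitionxx sP; have := itv_partitionxx sQ.
  by rewrite /Z => -> ->.
have tZ : t \in Z.
  by rewrite memZ; move: tP; rewrite inE gt_eqF//= => ->.
rewrite eq_le; apply/andP; split.
  have := mem_last s Z; rewrite inE => /predU1P[->|/Zst[]//]; exact: ltW.
move/splitPr : tZ sZ {memZ Zst} => [Z1 Z2]; rewrite cat_path /= last_cat /=.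
move=> /and3P[_ _ tZ2]; have := mem_last t Z2; rewrite inE => /predU1P[->//|].
by move: tZ2; rewrite lt_path_sortedE => /andP[/allP h _] /h/ltW.
Qed.

End Partitions.

(** * The sewing estimate on a finite grid *)

Section DiscreteSewing.
Context {R : realType}.
Implicit Types (th eps : R).

(** The solution [K] of [K = 2 + 2 K (1/2) ^ th], the recursion met when an
    interval is split into two parts that carry at most half of the mass each;
    it is positive precisely because [th > 1]. *)
Definition sewing_const th : R := 2 / (1 - 2 * (2^-1) `^ th).

Lemma half_powR_lt1 th : 1 < th -> 2 * (2^-1 : R) `^ th < 1.
Proof.
move=> th1.
have h : 0 < (2^-1 : R) by rewrite invr_gt0.
have -> : th = 1 + (th - 1) by lra.
rewrite powRD; last by apply/implyP => _; rewrite gt_eqF.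
rewrite powRr1 ?(ltW h)// mulrA divff ?gt_eqF// mul1r.
rewrite /powR gt_eqF// expR_lt1 pmulr_rlt0 ?subr_gt0//.
by rewrite ln_lt0// h/= invf_lt1 ?ltr1n.
Qed.

Lemma sewing_const_ge2 th : 1 < th -> 2 <= sewing_const th.
Proof.
move=> th1; rewrite /sewing_const ler_pdivlMr ?subr_gt0 ?half_powR_lt1//.
have := powR_ge0 (2^-1 : R) th; lra.
Qed.

Lemma sewing_constE th : 1 < th ->
  2 + 2 * (sewing_const th * (2^-1) `^ th) = sewing_const th.
Proof.
move=> th1; have := half_powR_lt1 th1; rewrite /sewing_const.
by set x := _ `^ th => x1; field; lra.
Qed.

(** By strong induction on the number of cells.  The grid interval is split at
    the cell that contains half of the mass [w i j]: on each side of it the mass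
    is at most [w i j / 2], so that the two inductive bounds lose a factor
    [2 * (1/2) ^ th < 1], and this leaves room for the two defects produced by
    the splitting.  Halving the mass, and not the number of points, makes the
    constant independent of the partition. *)
Lemma discrete_sewing th eps (N : nat) (w Xi : nat -> nat -> R) :
    1 < th -> 0 <= eps ->
    (forall i j, (i <= j <= N)%N -> 0 <= w i j) ->
    (forall i j k, (i <= j)%N -> (j <= k <= N)%N -> w i j + w j k <= w i k) ->
    (forall i j k, (i <= j)%N -> (j <= k <= N)%N ->
      `|Xi i k - Xi i j - Xi j k| <= eps * w i k `^ th) ->
  forall i j, (i <= j <= N)%N ->
    `|\sum_(i <= k < j) Xi k k.+1 - Xi i j|
      <= sewing_const th * (eps * w i j `^ th).
Proof.
move=> th1 eps0 w0 wD dXi i j.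
have th0 : 0 <= th by rewrite ltW// (lt_trans _ th1).
have K2 := sewing_const_ge2 th1; set K := sewing_const th in K2 *.
have ew x : 0 <= eps * x `^ th by rewrite mulr_ge0 ?powR_ge0.
have [n] := ubnP (j - i)%N; elim: n i j => // n IH i j jin /andP[ij jN].
move: ij jin; rewrite leq_eqVlt => /predU1P[-> _|ij jin].
  rewrite big_geq// sub0r normrN.
  have := dXi j j j (leqnn _); rewrite leqnn jN => /(_ isT).
  rewrite subrr sub0r normrN => /le_trans; apply.
  by rewrite -[leLHS]mul1r ler_wpM2r//; lra.
have wii0 : w i i = 0.
  have iN : (i <= i <= N)%N by rewrite leqnn (leq_trans (ltnW ij)).
  have := wD i i i (leqnn _) iN; have := w0 i i iN; lra.
have wjj0 : w j j = 0.
  have jjN : (j <= j <= N)%N by rewrite leqnn.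
  have := wD j j j (leqnn _) jjN; have := w0 j j jjN; lra.
have wij0 : 0 <= w i j by apply: w0; rewrite ltnW.
(* the last index m < j up to which at most half of the mass is used *)
have [m [im mj wim wmj]] : exists m, [/\ (i <= m)%N, (m < j)%N,
    w i m <= w i j / 2 & w m.+1 j <= w i j / 2].
  pose A m := [&& (i <= m)%N, (m < j)%N & w i m <= w i j / 2].
  have exA : exists m, A m.
    by exists i; rewrite /A leqnn ij wii0 divr_ge0.
  have ubA m : A m -> (m <= j)%N by case/and3P => _ /ltnW.
  case: (ex_maxnP exA ubA) => m /and3P[im mj wim] mmax.
  exists m; split => //.
  move: (mj); rewrite leq_eqVlt => /predU1P[->|m1j]; first by rewrite wjj0 divr_ge0.
  have [wm1|wm1] := leP (w i m.+1) (w i j / 2).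
    have := mmax m.+1; rewrite /A m1j wm1 (leq_trans im)//= ltnn.
    by move=> /(_ isT).
  have := wD i m.+1 j (leq_trans im (leqnSn _)); rewrite jN ltnW// => /(_ isT).
  lra.
have mN : (m <= N)%N by rewrite (leq_trans (ltnW mj)).
have IH1 : `|\sum_(i <= k < m) Xi k k.+1 - Xi i m|
    <= K * (eps * (w i j / 2) `^ th).
  apply: le_trans (IH i m _ _) _; last 1 first.
  - rewrite ler_wpM2l ?(le_trans _ K2)// ler_wpM2l// ler_powR_nneg// w0//.
    by rewrite im.
  - by rewrite -ltnS (leq_trans _ jin)// ltnS ltn_sub2r.
  - by rewrite im.
have IH2 : `|\sum_(m.+1 <= k < j) Xi k k.+1 - Xi m.+1 j|
    <= K * (eps * (w i j / 2) `^ th).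
  apply: le_trans (IH m.+1 j _ _) _; last 1 first.
  - rewrite ler_wpM2l ?(le_trans _ K2)// ler_wpM2l// ler_powR_nneg// w0//.
    by rewrite mj.
  - by rewrite -ltnS (leq_trans _ jin)// ltnS ltn_sub2l.
  - by rewrite mj.
have D1 : `|Xi i m.+1 - Xi i m - Xi m m.+1| <= eps * w i j `^ th.
  apply: le_trans (dXi i m m.+1 im _) _; first by rewrite leqnSn (leq_trans mj).
  have im1N : (i <= m.+1 <= N)%N by rewrite (leq_trans im)// (leq_trans mj).
  rewrite ler_wpM2l// ler_powR_nneg// ?w0//.
  have := wD i m.+1 j (leq_trans im (leqnSn _)); rewrite mj jN => /(_ isT).
  by have := w0 m.+1 j; rewrite mj jN => /(_ isT); lra.
have D2 : `|Xi i j - Xi i m.+1 - Xi m.+1 j| <= eps * w i j `^ th.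
  by apply: dXi; rewrite ?mj// (leq_trans im).
rewrite (big_cat_nat im (ltnW mj)) /= (big_ltn mj).
have KE := sewing_constE th1; rewrite -/K in KE; rewrite -KE.
move: IH1 IH2 D1 D2; rewrite powRM ?invr_ge0//.
set A := \sum_(_ <= _ < m) _; set B := \sum_(_ <= _ < j) _.
rewrite (mulrA eps); set e := eps * w i j `^ th.
move=> IH1 IH2 D1 D2.
have -> : A + (Xi m m.+1 + B) - Xi i j = (A - Xi i m) + (B - Xi m.+1 j)
    - (Xi i m.+1 - Xi i m - Xi m m.+1) - (Xi i j - Xi i m.+1 - Xi m.+1 j) by ring.
rewrite (le_trans (ler_normB _ _))// (le_trans (lerD (ler_normB _ _) (lexx _)))//.
rewrite (le_trans (lerD (lerD (ler_normD _ _) (lexx _)) (lexx _)))//.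
have -> : (2 + 2 * (K * 2^-1 `^ th)) * e =
  K * (e * 2^-1 `^ th) + K * (e * 2^-1 `^ th) + e + e by ring.
by rewrite !lerD.
Qed.

End DiscreteSewing.

(** * Convergence of sums of almost additive germs *)

Section Sewing.
Context {R : realType}.
Implicit Types (eps delta s t u a b c C : R) (P Q Z : seq R).
Variables (T th : R) (w : R -> R -> R) (Xi : R -> R -> R).
Hypothesis w_control : control T w.
Hypothesis th_gt1 : 1 < th.

(** The quantity written [delta Xi] in the theory of the sewing map. *)
Definition defect (s u t : R) : R := Xi s t - Xi s u - Xi u t.

Lemma sewing_bound eps s t P : 0 <= eps -> 0 <= s -> t <= T ->
    (forall a b c, s <= a -> a <= b -> b <= c -> c <= t ->
      `|defect a b c| <= eps * w a c `^ th) ->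
    itv_partition s t P ->
  `|psum Xi s P - Xi s t| <= sewing_const th * (eps * w s t `^ th).
Proof.
move=> eps0 s0 tT dXi sP; have [w0 wD] := w_control.
have ptb i : (i <= size P)%N -> s <= pt s P i /\ pt s P i <= t.
  exact: (pt_bounds sP).
have := @discrete_sewing _ th eps (size P)
  (fun i j => w (pt s P i) (pt s P j)) (fun i j => Xi (pt s P i) (pt s P j))
  th_gt1 eps0 _ _ _ 0%N (size P).
rewrite big_mkord pt0 (pt_size sP); apply.
- move=> i j /andP[ij jP]; have [? ?] := ptb _ (leq_trans ij jP).
  have [? ?] := ptb _ jP.
  by apply: w0; [lra|exact: (pt_leq sP)|lra].
- move=> i j k ij /andP[jk kP]; have jP := leq_trans jk kP.
  have [? ?] := ptb _ (leq_trans ij jP); have [? ?] := ptb _ kP.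
  by apply: wD; [lra|exact: (pt_leq sP)|exact: (pt_leq sP)|lra].
- move=> i j k ij /andP[jk kP]; have jP := leq_trans jk kP.
  have [? ?] := ptb _ (leq_trans ij jP); have [? ?] := ptb _ kP.
  by apply: dXi => //; exact: (pt_leq sP).
- by rewrite leqnn leq0n.
Qed.

(** Errors made on the cells of the coarse partition add up to the control of
    the whole interval by superadditivity. *)
Lemma psum_refine C delta s t P Z : 0 <= C -> 0 <= s -> t <= T ->
    (forall a b Q, s <= a -> b <= t -> b - a <= delta -> itv_partition a b Q ->
      `|psum Xi a Q - Xi a b| <= C * w a b) ->
    itv_partition s t P -> itv_partition s t Z -> {subset P <= Z} ->
    mesh s P <= delta ->
  `|psum Xi s Z - psum Xi s P| <= C * w s t.
Proof.
have [w0 wD] := w_control.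
move=> C0; elim: P s Z => [|x P IH] s Z s0 tT H sP sZ PZ.
  have st := itv_partition_nil sP; subst t.
  rewrite (itv_partitionxx sZ) psum_nil subrr normr0 mulr_ge0//.
  by move=> *; apply: w0.
rewrite mesh_cons ge_max => /andP[xd md].
have sx := itv_partition_cons_lt sP.
have xP := itv_partition_cons sP; have xt := itv_partition_le xP.
have xZ : x \in Z by apply: PZ; rewrite mem_head.
move/splitPr: xZ sZ PZ => [Z1 Z2] sZ PZ.
have sZ' : itv_partition s x (rcons Z1 x) /\ itv_partition x t Z2.
  case: sZ; rewrite -cat_rcons cat_path last_cat last_rcons => /andP[pZ1 pZ2] tl.
  by split; split => //; rewrite ?last_rcons.
case: sZ' => sZ1 xZ2.
rewrite -cat_rcons psum_cat last_rcons psum_cons.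
have PZ2 : {subset P <= Z2}.
  move=> y yP; have := PZ y; rewrite inE yP orbT => /(_ isT).
  have xy : x < y by case: xP => + _; rewrite lt_path_sortedE => /andP[/allP h _]; exact: h.
  rewrite -cat_rcons mem_cat => /orP[|//] yZ1; exfalso.
  have : y <= x.
    have -> : y = pt s (rcons Z1 x) (index y (rcons Z1 x)).+1 by rewrite /pt /= nth_index.
    by apply: (pt_bounds sZ1 _).2; rewrite index_mem.
  by move=> yx; have := lt_le_trans xy yx; rewrite ltxx.
have I1 : `|psum Xi s (rcons Z1 x) - Xi s x| <= C * w s x by apply: H.
have I2 : `|psum Xi x Z2 - psum Xi x P| <= C * w x t.
  apply: IH => //; first by lra.
  by move=> a b Q xa; apply: H; lra.
rewrite (_ : _ - _ = (psum Xi s (rcons Z1 x) - Xi s x) +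
                    (psum Xi x Z2 - psum Xi x P)); last by ring.
rewrite (le_trans (ler_normD _ _))// (le_trans (lerD I1 I2))// -mulrDr.
by rewrite ler_wpM2l//; apply: wD => //; exact: ltW.
Qed.

Lemma psum_two_partitions C delta s t P Q : 0 <= C -> 0 <= s -> t <= T ->
    (forall a b Q, s <= a -> b <= t -> b - a <= delta -> itv_partition a b Q ->
      `|psum Xi a Q - Xi a b| <= C * w a b) ->
    itv_partition s t P -> itv_partition s t Q ->
    mesh s P <= delta -> mesh s Q <= delta ->
  `|psum Xi s P - psum Xi s Q| <= 2 * (C * w s t).
Proof.
move=> C0 s0 tT H sP sQ mP mQ.
(* compare both partitions with a common refinement *)
have [Z [sZ PZ QZ]] := common_refinement sP sQ.
have h1 := psum_refine C0 s0 tT H sP sZ PZ mP.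
have h2 := psum_refine C0 s0 tT H sQ sZ QZ mQ.
rewrite (_ : _ - _ = (psum Xi s Z - psum Xi s Q) - (psum Xi s Z - psum Xi s P));
  last by ring.
by rewrite (le_trans (ler_normB _ _))// mulr2n mulrDl mul1r lerD.
Qed.

Hypothesis defect_small : forall eps : R, 0 < eps ->
  exists2 delta : R, 0 < delta &
    forall s u t, 0 <= s -> s <= u -> u <= t -> t <= T -> t - s <= delta ->
      `|defect s u t| <= eps * w s t `^ th.

Lemma control_le0T s t : 0 <= s -> s <= t -> t <= T -> w s t <= w 0 T.
Proof.
have [w0 wD] := w_control; move=> s0 st tT.
have := wD 0 s T (lexx _) s0 (le_trans st tT) (lexx _).
have := wD s t T s0 st tT (lexx _).
have := w0 0 s (lexx _) s0 (le_trans st tT).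
have := w0 t T (le_trans s0 st) tT (lexx _); lra.
Qed.

(** The bound does not depend on [t], because all the masses are at most
    [w 0 T]; this is what makes the convergence of the integrals uniform. *)
Lemma psum_cauchy eps : 0 < eps -> exists2 delta : R, 0 < delta &
  forall t P Q, t <= T -> itv_partition 0 t P -> itv_partition 0 t Q ->
    mesh 0 P < delta -> mesh 0 Q < delta -> `|psum Xi 0 P - psum Xi 0 Q| <= eps.
Proof.
move=> eps0; have [w0 wD] := w_control.
have [K KE K2] : exists2 K, K = sewing_const th & 2 <= K.
  by exists (sewing_const th); last exact: sewing_const_ge2.
have K0 : 0 <= K by exact: le_trans K2.
pose W := `|w 0 T| `^ (th - 1).
have W0 : 0 <= W by exact: powR_ge0.
(* an upper bound of the final constant, made positive by adding 1 *)
pose M := 2 * K * W * `|w 0 T| + 1.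
have M1 : 1 <= M.
  by rewrite lerDr !mulr_ge0//.
have M0 : 0 < M by lra.
have [|delta delta0 H] := defect_small (eps := eps / M).
  by rewrite divr_gt0.
exists delta => // t P Q tT tP tQ mP mQ.
have t0 := itv_partition_le tP.
pose C := K * (eps / M) * W.
have eM0 : 0 <= eps / M by rewrite divr_ge0// ltW.
have C0 : 0 <= C by rewrite mulr_ge0// mulr_ge0.
apply: le_trans (psum_two_partitions (C := C) (delta := delta) C0 _ tT _
  tP tQ (ltW mP) (ltW mQ)) _; rewrite ?lexx//.
  move=> a b Z a0 bt ba aZ; have ab := itv_partition_le aZ.
  have wab0 : 0 <= w a b by apply: w0 => //; lra.
  apply: le_trans (@sewing_bound (eps / M) a b Z eM0 a0 _ _ aZ) _ => //.
  - by lra.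
  - move=> x y z ax xy yz zb.
    have le1 : `|defect x y z| <= eps / M * w x z `^ th by apply: H => //; lra.
    exact: le1.
  - rewrite -KE /C -(mulrA (K * _)) -(mulrA K) ler_wpM2l// ler_wpM2l//.
    have := @powR_exp_lower R (w a b) `|w 0 T| th 1 wab0.
    rewrite -/W powRr1// => h; rewrite h//; last exact: ltW.
    by rewrite (le_trans _ (ler_norm _))// control_le0T//; lra.
have w0t : w 0 t <= `|w 0 T| by rewrite (le_trans _ (ler_norm _))// control_le0T.
apply: (@le_trans _ _ (2 * (C * `|w 0 T|))).
  by rewrite ler_wpM2l// ler_wpM2l.
rewrite /C (_ : _ * _ = eps * ((2 * K * W * `|w 0 T|) / M)); last by field; lra.
rewrite -[leRHS]mulr1 ler_wpM2l ?(ltW eps0)// ler_pdivrMr// mul1r /M; lra.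
Qed.

Lemma mesh_filter_proper s t : s <= t -> ProperFilter (mesh_filter s t).
Proof.
move=> st; apply: Build_ProperFilter_ex => A [e /= e0 eA].
have e2 : 0 < e / 2 by rewrite divr_gt0.
have [P [sP mP]] := exists_fine_partition st e2.
exists P; apply: eA; split => //; lra.
Qed.

Lemma psum_cvg t : 0 <= t -> t <= T ->
  cvg (psum Xi 0 P @[P --> mesh_filter 0 t]).
Proof.
move=> t0 tT; have FF := mesh_filter_proper t0.
apply/cauchy_cvgP; apply/cauchy_ballP => e e0.
have [|delta d0 H] := @psum_cauchy (e / 2); first by rewrite divr_gt0.
pose A := [set P | itv_partition 0 t P /\ mesh 0 P < delta].
have FA : mesh_filter 0 t A by exists delta.
rewrite near_map2; near=> P Q; rewrite /= /ball /=.
have [tP mP] : A P by near: P.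
have [tQ mQ] : A Q by near: Q.
by have := H t P Q tT tP tQ mP mQ; lra.
Unshelve. all: by end_near. Qed.

Lemma psum_lim_uniform eps : 0 < eps -> exists2 delta : R, 0 < delta &
  forall t P, t <= T -> itv_partition 0 t P -> mesh 0 P < delta ->
    `|psum Xi 0 P - lim (psum Xi 0 Q @[Q --> mesh_filter 0 t])| <= eps.
Proof.
move=> eps0; have [delta d0 H] := psum_cauchy eps0.
exists delta => // t P tT tP mP.
have t0 := itv_partition_le tP.
have FF := mesh_filter_proper t0.
have tA : mesh_filter 0 t [set Q | itv_partition 0 t Q /\ mesh 0 Q < delta].
  by exists delta.
have cv := psum_cvg t0 tT.
have close Q : itv_partition 0 t Q /\ mesh 0 Q < delta ->
    `|psum Xi 0 P - psum Xi 0 Q| <= eps by case=> tQ mQ; exact: (H t).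
rewrite ler_distlC; apply/andP; split.
- by apply: limr_ge cv _; apply: filterS tA => Q /close; rewrite ler_distlC => /andP[].
- by apply: limr_le cv _; apply: filterS tA => Q /close; rewrite ler_distlC => /andP[].
Qed.

End Sewing.

(** * Comparison of matrix norms *)

Section MatrixNorms.
Context {R : realType}.

Lemma mx_norm_le m n (A : 'M[R]_(m, n)) (M : R) : 0 <= M ->
  (forall i j, `|A i j| <= M) -> `|A| <= M.
Proof.
move=> M0 H; rewrite [leLHS]/Num.norm /= mx_normrE.
by apply: bigmax_le => // -[i j] _; exact: H.
Qed.

Lemma coord_le_norm m n (A : 'M[R]_(m, n)) i j : `|A i j| <= `|A|.
Proof.
by rewrite [leRHS]/Num.norm /= mx_normrE (bigmax_sup (i, j)).
Qed.

Lemma enorm_ge0 m n (A : 'M[R]_(m, n)) : 0 <= enorm A.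
Proof. exact: sqrtr_ge0. Qed.

Lemma norm_le_enorm m n (A : 'M[R]_(m, n)) : `|A| <= enorm A.
Proof.
apply: mx_norm_le => [|i j]; first exact: enorm_ge0.
rewrite -sqrtr_sqr; apply: ler_wsqrtr.
rewrite (bigD1 i)//= (bigD1 j)//= -addrA lerDl addr_ge0//.
  by apply: sumr_ge0 => *; exact: sqr_ge0.
by apply: sumr_ge0 => *; apply: sumr_ge0 => *; exact: sqr_ge0.
Qed.

Lemma enorm_le_norm m n (A : 'M[R]_(m, n)) : enorm A <= (m * n)%:R * `|A|.
Proof.
rewrite -(@ger0_norm _ ((m * n)%:R * `|A|)); last exact: mulr_ge0.
rewrite -sqrtr_sqr; apply: ler_wsqrtr.
apply: (@le_trans _ _ (\sum_(i < m) \sum_(j < n) `|A| ^+ 2)).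
  apply: ler_sum => i _; apply: ler_sum => j _.
  by rewrite -real_normK ?num_real// lerXn2r ?nnegrE// coord_le_norm.
rewrite !sumr_const !card_ord -mulrnA exprMn -[leLHS]mulr_natl.
rewrite ler_wpM2r ?sqr_ge0// -natrX ler_nat mulnC.
by case: (m * n)%N => // k; rewrite expnS expn1 leq_pmulr.
Qed.

Lemma enorm0 m n : enorm (0 : 'M[R]_(m, n)) = 0.
Proof.
apply/eqP; rewrite eq_le enorm_ge0 andbT.
by have := enorm_le_norm (0 : 'M[R]_(m, n)); rewrite normr0 mulr0.
Qed.

Lemma norm_sum_le d (g : 'I_d -> R) (M : R) :
  (forall i, `|g i| <= M) -> `|\sum_i g i| <= d%:R * M.
Proof.
move=> H; apply: le_trans (ler_norm_sum _ _ _) _.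
apply: le_trans (ler_sum _ (fun i _ => H i)) _.
by rewrite sumr_const card_ord mulr_natl.
Qed.

Lemma dotp_le d (u v : 'rV[R]_d) : `|dotp u v| <= d%:R * (`|u| * `|v|).
Proof.
by apply: norm_sum_le => i; rewrite normrM ler_pM// coord_le_norm.
Qed.

Lemma contract_le d (A B M : 'M[R]_d) :
  `|contract A B M| <= d%:R ^+ 3 * (`|A| * `|B| * `|M|).
Proof.
rewrite !exprS expr0 mulr1 -!mulrA; do 3!apply: norm_sum_le => ?.
by rewrite !normrM -mulrA !ler_pM ?mulr_ge0// coord_le_norm.
Qed.

Lemma mulmx_tr_le d e (v : 'rV[R]_d) (A : 'M[R]_(e, d)) :
  `|v *m A^T| <= d%:R * (`|v| * `|A|).
Proof.
apply: mx_norm_le => [|i j]; first by rewrite !mulr_ge0.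
rewrite mxE; apply: norm_sum_le => k.
by rewrite normrM mxE ler_pM// coord_le_norm.
Qed.

Lemma tensor_le d (u v : 'rV[R]_d) : `|tensor u v| <= `|u| * `|v|.
Proof.
apply: mx_norm_le => [|i j]; first by rewrite mulr_ge0.
by rewrite mxE big_ord1 !mxE normrM ler_pM// coord_le_norm.
Qed.

End MatrixNorms.

(** * The defect of the compensated germ *)

Section Germ.
Context {R : realType} {d : nat}.
Implicit Types (u v : 'rV[R]_d) (A B M : 'M[R]_d).

Lemma dotpDl u1 u2 v : dotp (u1 + u2) v = dotp u1 v + dotp u2 v.
Proof. by rewrite -big_split; apply: eq_bigr => i _; rewrite mxE mulrDl. Qed.

Lemma dotpDr u v1 v2 : dotp u (v1 + v2) = dotp u v1 + dotp u v2.
Proof. by rewrite -big_split; apply: eq_bigr => i _; rewrite mxE mulrDr. Qed.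

Lemma dotp0r u : dotp u 0 = 0.
Proof. by rewrite /dotp big1// => i _; rewrite mxE mulr0. Qed.

Lemma contractDl A1 A2 B M :
  contract (A1 + A2) B M = contract A1 B M + contract A2 B M.
Proof.
rewrite -big_split; apply: eq_bigr => i _ /=; rewrite -big_split.
apply: eq_bigr => j _ /=; rewrite -big_split; apply: eq_bigr => k _ /=.
by rewrite !mxE !mulrDl.
Qed.

Lemma contractDm A B1 B2 M :
  contract A (B1 + B2) M = contract A B1 M + contract A B2 M.
Proof.
rewrite -big_split; apply: eq_bigr => i _ /=; rewrite -big_split.
apply: eq_bigr => j _ /=; rewrite -big_split; apply: eq_bigr => k _ /=.
by rewrite !mxE mulrDr mulrDl.
Qed.

Lemma contractDr A B M1 M2 :
  contract A B (M1 + M2) = contract A B M1 + contract A B M2.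
Proof.
rewrite -big_split; apply: eq_bigr => i _ /=; rewrite -big_split.
apply: eq_bigr => j _ /=; rewrite -big_split; apply: eq_bigr => k _ /=.
by rewrite !mxE mulrDr.
Qed.

Lemma dotp_mulmx_tr u v A B :
  dotp (u *m A^T) (v *m B^T) = contract A B (tensor u v).
Proof.
apply: eq_bigr => i _; rewrite !mxE mulr_suml; apply: eq_bigr => j _.
rewrite mulr_sumr; apply: eq_bigr => k _.
by rewrite !mxE big_ord1 !mxE; ring.
Qed.

Lemma incrD (V : zmodType) (X : R -> V) (s u t : R) :
  incr X s t = incr X s u + incr X u t.
Proof. by rewrite /incr [RHS]addrC addrA subrK. Qed.

Lemma incr_eq (V : zmodType) (X : R -> V) s t : X t = X s + incr X s t.
Proof. by rewrite /incr subrKC. Qed.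

(** Chen's relation. *)
Definition chen (S : R -> 'rV[R]_d) (SS : R -> R -> 'M[R]_d) : Prop :=
  forall s u t : R, SS s t = SS s u + SS u t + tensor (incr S s u) (incr S u t).

Definition germ (SS : R -> R -> 'M[R]_d) (F : R -> 'rV[R]_d) (F' : R -> 'M[R]_d)
    (G : R -> 'rV[R]_d) (G' : R -> 'M[R]_d) (s v : R) : R :=
  dotp (F s) (incr G s v) + contract (F' s) (G' s) (SS s v).

(** Expand the increments of [F] and [G] by their Gubinelli derivatives: the
    terms without remainder that contain [S_(s,u)] and [S_(u,t)] cancel against
    Chen's relation for [SS], except for the variation of [G'] over [s, u]. *)
Lemma germ_defectE S SS F F' G G' (s u t : R) : chen S SS ->
  defect (germ SS F F' G G') s u t =
  - (dotp (remainder S F F' s u) (incr G u t)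
     + dotp (incr S s u *m (F' s)^T) (remainder S G G' u t)
     + contract (F' s) (incr G' s u) (tensor (incr S s u) (incr S u t))
     + contract (incr F' s u) (G' u) (SS u t)
     + contract (F' s) (incr G' s u) (SS u t)).
Proof.
move=> chenS; rewrite /defect /germ (chenS s u t) (incrD G s u t) dotpDr.
rewrite !contractDr (incr_eq F s u) dotpDl.
have -> : incr F s u = remainder S F F' s u + incr S s u *m (F' s)^T.
  by rewrite /remainder subrK.
rewrite dotpDl.
have -> : dotp (incr S s u *m (F' s)^T) (incr G u t) =
    dotp (incr S s u *m (F' s)^T) (remainder S G G' u t) +
    contract (F' s) (G' u) (tensor (incr S s u) (incr S u t)).
  by rewrite -dotp_mulmx_tr -dotpDr /remainder subrK.
rewrite (incr_eq F' s u) (incr_eq G' s u) !(contractDl, contractDm).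
ring.
Qed.

(** Here [a] and [b] stand for [w ^ alpha] and [w ^ beta].  Each of the five
    terms of the defect contains a first or second level increment of the rough
    path, which yields the small factor [rho]. *)
Lemma germ_defect_le S SS F F' G G' (s u t C rho a b : R) :
    chen S SS -> 0 <= C -> 0 <= rho -> 0 <= a -> 0 <= b ->
    `|F' s| <= C -> `|G' u| <= C ->
    `|remainder S F F' s u| <= C * (a * b) -> `|incr G u t| <= C * (rho * a) ->
    `|incr S s u| <= rho * a -> `|incr S u t| <= C * a ->
    `|remainder S G G' u t| <= C * (a * b) ->
    `|incr F' s u| <= C * b -> `|incr G' s u| <= C * b ->
    `|SS u t| <= rho * (a * a) ->
  `|defect (germ SS F F' G G') s u t| <=
    (d%:R * C ^+ 2 + d%:R ^+ 2 * C ^+ 2 + d%:R ^+ 3 * C ^+ 3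
       + 2 * (d%:R ^+ 3 * C ^+ 2)) * rho * (a * a * b).
Proof.
move=> chenS C0 rho0 a0 b0 F's G'u RF Gut Ssu Sut RG F'su G'su SSut.
rewrite (germ_defectE _ _ _ _ _ _ _ chenS) normrN.
have d0 : 0 <= d%:R :> R by [].
have T1 : `|dotp (remainder S F F' s u) (incr G u t)|
    <= d%:R * ((C * (a * b)) * (C * (rho * a))).
  by apply: le_trans (dotp_le _ _) _; rewrite ler_wpM2l// ler_pM.
have T2 : `|dotp (incr S s u *m (F' s)^T) (remainder S G G' u t)|
    <= d%:R * ((d%:R * ((rho * a) * C)) * (C * (a * b))).
  apply: le_trans (dotp_le _ _) _; rewrite ler_wpM2l// ler_pM//.
  by apply: le_trans (mulmx_tr_le _ _) _; rewrite ler_wpM2l// ler_pM.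
have T3 : `|contract (F' s) (incr G' s u) (tensor (incr S s u) (incr S u t))|
    <= d%:R ^+ 3 * (C * (C * b) * ((rho * a) * (C * a))).
  apply: le_trans (contract_le _ _ _) _.
  rewrite ler_wpM2l ?exprn_ge0// ler_pM ?mulr_ge0//; first by rewrite ler_pM.
  by apply: le_trans (tensor_le _ _) _; rewrite ler_pM.
have T4 : `|contract (incr F' s u) (G' u) (SS u t)|
    <= d%:R ^+ 3 * ((C * b) * C * (rho * (a * a))).
  apply: le_trans (contract_le _ _ _) _.
  by rewrite ler_wpM2l ?exprn_ge0// ler_pM ?mulr_ge0// ler_pM.
have T5 : `|contract (F' s) (incr G' s u) (SS u t)|
    <= d%:R ^+ 3 * (C * (C * b) * (rho * (a * a))).
  apply: le_trans (contract_le _ _ _) _.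
  by rewrite ler_wpM2l ?exprn_ge0// ler_pM ?mulr_ge0// ler_pM.
set K := _ + 2 * _.
have -> : K * rho * (a * a * b) =
  d%:R * ((C * (a * b)) * (C * (rho * a)))
  + d%:R * ((d%:R * ((rho * a) * C)) * (C * (a * b)))
  + d%:R ^+ 3 * (C * (C * b) * ((rho * a) * (C * a)))
  + d%:R ^+ 3 * ((C * b) * C * (rho * (a * a)))
  + d%:R ^+ 3 * (C * (C * b) * (rho * (a * a))) by rewrite /K; ring.
by do 4!rewrite (le_trans (ler_normD _ _))// lerD//.
Qed.

End Germ.

(** * Controls and finite variation *)

Section Variation.
Context {R : realType}.
Implicit Types (T a s t u C : R) (P Q : seq R) (w Xi : R -> R -> R).

Lemma itv_partition_exists s t : s <= t -> exists P, itv_partition s t P.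
Proof.
rewrite le_eqVlt => /predU1P[->|st]; first by exists [::]; split => /=.
by exists [:: t]; exact: itv_partition1.
Qed.

Lemma psum_ge0 Xi s P : (forall x y, 0 <= Xi x y) -> 0 <= psum Xi s P.
Proof. by move=> Xi0; apply: sumr_ge0. Qed.

(** Superadditivity of the control. *)
Lemma psum_le_control T w Xi C s t P : control T w -> 0 <= C ->
  (forall x y, 0 <= x -> x <= y -> y <= T -> Xi x y <= C * w x y) ->
  0 <= s -> t <= T -> itv_partition s t P -> psum Xi s P <= C * w s t.
Proof.
move=> [w0 wD] C0 H; elim: P s => [|x P IH] s s0 tT sP.
  rewrite psum_nil; have <- := itv_partition_nil sP.
  have st := itv_partition_nil sP; rewrite mulr_ge0// w0//; first by rewrite st.
have sx := itv_partition_cons_lt sP; have xP := itv_partition_cons sP.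
have xt := itv_partition_le xP.
rewrite psum_cons (@le_trans _ _ (C * w s x + C * w x t))//.
  by rewrite lerD//; [apply: H; lra|apply: IH => //; lra].
by rewrite -mulrDr ler_wpM2l//; apply: wD => //; lra.
Qed.

Lemma pvar_lty T w m n (A : R -> R -> 'M[R]_(m, n)) a C : control T w ->
  0 <= T -> 0 < a -> 0 <= C ->
  (forall x y, 0 <= x -> x <= y -> y <= T -> enorm (A x y) `^ a <= C * w x y) ->
  (pvar a A 0 T < +oo)%E.
Proof.
move=> cw T0 a0 C0 H; apply: (@le_lt_trans _ _ ((C * w 0 T) `^ a^-1)%:E); last exact: ltry.
apply: ge_ereal_sup => _ [P TP <-]; rewrite lee_fin.
apply: ler_powR_nneg; first by rewrite invr_ge0 ltW.
  by apply: sumr_ge0 => *; exact: powR_ge0.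
exact: (@psum_le_control T w (fun x y => enorm (A x y) `^ a)).
Qed.

(** The control is the supremum of the sums of [a]-th powers over the partitions
    of [s, t]: concatenating partitions makes it superadditive, and extending
    them to [0, T] makes it finite. *)
Lemma pvar_control T m n (A : R -> R -> 'M[R]_(m, n)) a : 0 < a -> 0 <= T ->
  (forall s, A s s = 0) -> (pvar a A 0 T < +oo)%E ->
  exists2 w, control T w &
    forall s t, 0 <= s -> s <= t -> t <= T -> enorm (A s t) <= w s t `^ a^-1.
Proof.
move=> a0 T0 A0 Afin; pose Xi s t := enorm (A s t) `^ a.
have Xi0 x y : 0 <= Xi x y by exact: powR_ge0.
have [M HM] : exists M, forall P, itv_partition 0 T P -> psum Xi 0 P <= M.
  exists (fine (pvar a A 0 T) `^ a) => P TP.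
  have leP : ((psum Xi 0 P `^ a^-1)%:E <= pvar a A 0 T)%E.
    by apply: ereal_sup_ubound; exists P.
  have pfin : pvar a A 0 T \is a fin_num.
    by rewrite fin_numE -ltNye -ltey Afin andbT (lt_le_trans (ltNyr _) leP).
  have p0 : psum Xi 0 P = (psum Xi 0 P `^ a^-1) `^ a.
    by rewrite -powRrM mulVf ?gt_eqF// powRr1// psum_ge0.
  rewrite p0; apply: ler_powR_nneg; rewrite ?powR_ge0 ?(ltW a0)//.
  by rewrite -lee_fin fineK.
have {}HM s t P : 0 <= s -> t <= T -> itv_partition s t P -> psum Xi s P <= M.
  move=> s0 tT sP.
  have [P1 sP1] := itv_partition_exists s0.
  have [P2 tP2] := itv_partition_exists tT.
  have := HM _ (itv_partition_cat sP1 (itv_partition_cat sP tP2)).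
  have [_ /eqP l1] := sP1; have [_ /eqP l] := sP.
  rewrite !psum_cat l1 l.
  have := psum_ge0 0 P1 Xi0; have := psum_ge0 t P2 Xi0; lra.
pose V s t := [set psum Xi s P | P in itv_partition s t].
have hV s t : 0 <= s -> s <= t -> t <= T -> has_sup (V s t).
  move=> s0 st tT; split.
    by have [P sP] := itv_partition_exists st; exists (psum Xi s P), P.
  by exists M => _ [P sP <-]; exact: HM sP.
have leV s t P : 0 <= s -> t <= T -> itv_partition s t P -> psum Xi s P <= sup (V s t).
  move=> s0 tT sP; apply: sup_upper_bound; last by exists P.
  by apply: hV => //; exact: itv_partition_le sP.
exists (fun s t => sup (V s t)).
  split=> [s t s0 st tT|s u t s0 su ut tT].
    have [P sP] := itv_partition_exists st.
    exact: le_trans (psum_ge0 _ _ Xi0) (leV _ _ _ _ _ sP).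
  rewrite -lerBrDr; apply: ge_sup => [|_ [P sP <-]].
    by have [|||? _] := hV s u => //; lra.
  rewrite lerBrDr addrC -lerBrDr; apply: ge_sup => [|_ [Q uQ <-]].
    by have [|||? _] := hV u t => //; lra.
  rewrite lerBrDr addrC.
  have [_ /eqP l] := sP.
  have := leV s t (P ++ Q) s0 tT (itv_partition_cat sP uQ).
  by rewrite psum_cat l.
move=> s t s0 st tT; apply: powR_root_le => //; first exact: enorm_ge0.
move: st; rewrite le_eqVlt => /predU1P[ts|st].
  subst t; rewrite A0 enorm0 powR0 ?gt_eqF//.
  have sP : itv_partition s s [::] by split => /=.
  by have := leV s s _ s0 tT sP; rewrite psum_nil.
have := leV s t _ s0 tT (itv_partition1 st).
by rewrite psum_cons psum_nil addr0.
Qed.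

Lemma controlD T w1 w2 : control T w1 -> control T w2 ->
  control T (fun s t => w1 s t + w2 s t).
Proof.
move=> [p1 s1] [p2 s2]; split=> [s t s0 st tT|s u t s0 su ut tT].
  by rewrite addr_ge0 ?p1 ?p2.
by have := s1 s u t s0 su ut tT; have := s2 s u t s0 su ut tT; lra.
Qed.

End Variation.

(** * Paths on a compact interval *)

Section CompactInterval.
Context {R : realType}.
Implicit Types (T s t eps delta M : R).

Lemma within_itvP (U : topologicalType) T (X : R -> U) :
  {within `[0, T], continuous X} <->
  (forall t, 0 <= t -> t <= T -> X x @[x --> within `[0, T] (nbhs t)] --> X t).
Proof.
split=> [/subspace_continuousP H t t0 tT|H].
  by apply: H; rewrite /= in_itv /= t0.
by apply/subspace_continuousP => t /=; rewrite in_itv /= => /andP[]; exact: H.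
Qed.

Lemma uniformly_continuous_itv (V : normedModType R) T (X : R -> V) eps :
  {within `[0, T], continuous X} -> 0 < eps ->
  exists2 delta : R, 0 < delta & forall s t, 0 <= s -> s <= T -> 0 <= t -> t <= T ->
    `|t - s| <= delta -> `|X t - X s| <= eps.
Proof.
move=> /within_itvP cX e0.
have /near_covering_withinP cov :=
  (compact_near_coveringP _).1 (@segment_compact R 0 T).
(* Heine's theorem: the property Q delta holds near every point of [0, T] for
   all small delta, hence on the whole of [0, T] by compactness. *)
pose Q (delta t : R) := forall s, 0 <= s -> s <= T -> `|t - s| < delta ->
  `|X t - X s| <= eps.
have : \forall delta \near 0^'+, `[0, T] `<=` Q delta.
  apply: cov => x; rewrite /= in_itv /= => /andP[x0 xT].
  have e2 : 0 < eps / 2 by rewrite divr_gt0.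
  have /cvgrPdist_lt /(_ _ e2) := cX x x0 xT.
  rewrite near_withinE => /nbhs_ballP [r /= r0 rX].
  have r2 : 0 < r / 2 by rewrite divr_gt0.
  exists (ball x (r / 2), [set delta | delta < r / 2]).
    by split => /=; [exact: nbhsx_ballx|exact: nbhs_right_lt].
  move=> [y delta] /= [xy dr]; rewrite in_itv /= => /andP[y0 yT] s s0 sT ys.
  have xy' : `|x - y| < r / 2 by [].
  have h1 : `|X x - X y| < eps / 2.
    by apply: rX; rewrite /ball /= ?in_itv /= ?y0//; lra.
  have h2 : `|X x - X s| < eps / 2.
    apply: rX; rewrite /ball /= ?in_itv /= ?s0//.
    by have := ler_distD y x s; lra.
  by have := ler_distD (X x) (X y) (X s); rewrite (distrC (X y) (X x)); lra.
move=> H; have [delta [d0 dX]] : exists delta : R, 0 < delta /\ `[0, T] `<=` Q delta.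
  near (0 : R)^'+ => delta; exists delta; split; first by near: delta; exact: nbhs_right_gt.
  by near: delta.
exists (delta / 2); first by rewrite divr_gt0.
move=> s t s0 sT t0 tT ts; apply: dX => //; first by rewrite /= in_itv /= t0.
lra.
Unshelve. all: by end_near. Qed.

Lemma bounded_itv (V : normedModType R) T (X : R -> V) :
  {within `[0, T], continuous X} ->
  exists2 M, 0 <= M & forall t, 0 <= t -> t <= T -> `|X t| <= M.
Proof.
move=> cX; have := compact_bounded (continuous_compact cX (@segment_compact R 0 T)).
move=> [M [_ HM]].
exists (`|M| + 1); first by rewrite addr_ge0.
move=> t t0 tT; apply: HM; first by have := ler_norm M; lra.
by exists t => //=; rewrite in_itv /= t0.
Qed.

Lemma uniform_itvP (V : pseudoMetricNormedZmodType R) T (f : nat -> R -> V) (g : R -> V) :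
  {uniform `[0, T], f n @[n --> \oo] --> g} <->
  (forall eps, 0 < eps -> \forall n \near \oo, forall t, 0 <= t -> t <= T ->
     `|g t - f n t| < eps).
Proof.
split=> [H eps e0|H].
  have /H : nbhs (g : {uniform` `[0, T] -> V})
      [set h | forall t, 0 <= t -> t <= T -> `|g t - h t| < eps].
    apply/uniform_nbhs; exists [set xy | ball xy.1 eps xy.2]; split.
      exact: (entourage_ball V (PosNum e0)).
    move=> h /= Hh t t0 tT; have := Hh t; rewrite in_itv /= t0 tT => /(_ isT).
    by rewrite -ball_normE.
  by [].
move=> A /uniform_nbhs [E [entE EA]].
move: entE; rewrite -entourage_ballE => -[eps /= e0 ballE].
have := H _ e0; apply: filterS => n Hn; apply: EA => t /=.
rewrite in_itv /= => /andP[t0 tT]; apply: ballE => /=.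
by rewrite -ball_normE /=; exact: Hn.
Qed.

End CompactInterval.

(** * Taylor estimates *)

Section Calculus.
Context {R : realType} {d : nat}.

(** The derivative along a line is the directional derivative, that is, the
    Jacobian applied to the direction. *)
Lemma is_derive_line m (g : 'rV[R]_d -> 'rV[R]_m) (x h : 'rV[R]_d) (j : 'I_m) (tau : R) :
  differentiable g (x + tau *: h) ->
  is_derive tau 1 (fun r : R => g (x + r *: h) 0 j)
    ((h *m jacobian g (x + tau *: h)) 0 j).
Proof.
move=> dg; have dgh := @diff_derivable _ _ _ g (x + tau *: h) h dg.
have cv : (fun e : R => e^-1 *: (g (x + (e *: (1 : R) + tau) *: h) 0 j
    - g (x + tau *: h) 0 j : R)) @ 0^' -->
    (('D_h g (x + tau *: h)) 0 j : R).
  have cg : (fun e : R => e^-1 *: ((g \o shift (x + tau *: h)) (e *: h)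
      - g (x + tau *: h))) @ 0^' --> 'D_h g (x + tau *: h) by exact: dgh.
  apply: cvg_trans (continuous_cvg _
    (@coord_continuous R 1 m 0 j ('D_h g (x + tau *: h))) cg).
  apply: near_eq_cvg; near=> e.
  by rewrite /= !mxE [e *: 1]mulr1 scalerDl addrCA.
rewrite deriveEjacobian// in cv.
by apply: DeriveDef; [apply/cvg_ex; eexists; exact: cv|exact: cvg_lim cv].
Unshelve. all: by end_near. Qed.

Lemma mean_value_coord m (g : 'rV[R]_d -> 'rV[R]_m) (x h : 'rV[R]_d) (j : 'I_m) :
  (forall z, differentiable g z) ->
  exists2 tau : R, 0 <= tau <= 1 &
    (g (x + h) - g x) 0 j = (h *m jacobian g (x + tau *: h)) 0 j.
Proof.
move=> dg.
have D (r : R) := is_derive_line j (dg (x + r *: h)).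
have [|c] := @MVT_segment R (fun r => g (x + r *: h) 0 j)
  (fun r => (h *m jacobian g (x + r *: h)) 0 j) 0 1 ler01 (fun r _ => D r).
  by apply: derivable_within_continuous => r _; have [] := D r.
rewrite in_itv /= => c01; rewrite scale1r scale0r addr0 subr0 mulr1 => E.
by exists c => //; rewrite !mxE in E *.
Qed.

(** [A = 0] gives a Lipschitz estimate, and the Jacobian of [g] at [x] in
    place of [A] gives the second order Taylor estimate. *)
Lemma mean_value_le m (g : 'rV[R]_d -> 'rV[R]_m) (x y : 'rV[R]_d)
    (A : 'M[R]_(d, m)) (B : R) : (forall z, differentiable g z) -> 0 <= B ->
  (forall tau, 0 <= tau <= 1 -> `|jacobian g (x + tau *: (y - x)) - A| <= B) ->
  `|g y - g x - (y - x) *m A| <= d%:R * (`|y - x| * B).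
Proof.
move=> dg B0 H; apply: mx_norm_le => [|i j]; first by rewrite !mulr_ge0.
rewrite ord1; have [tau t01 E] := mean_value_coord x (y - x) j dg.
rewrite subrKC in E.
rewrite mxE [X in _ + X]mxE E.
rewrite (_ : _ - _ = ((y - x) *m (jacobian g (x + tau *: (y - x)) - A)) 0 j).
  apply: le_trans (coord_le_norm _ _ _) _.
  rewrite -[X in _ *m X]trmxK; apply: le_trans (mulmx_tr_le _ _) _.
  rewrite ler_wpM2l// ler_wpM2l//; apply: le_trans (H tau t01).
  by apply: mx_norm_le => // a b; rewrite mxE coord_le_norm.
by rewrite mulmxBr [RHS]mxE [X in _ = _ + X]mxE.
Qed.

Lemma segment_norm_le (x y : 'rV[R]_d) (M tau : R) : `|x| <= M -> `|y| <= M ->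
  0 <= tau <= 1 -> `|x + tau *: (y - x)| <= M.
Proof.
move=> xM yM /andP[t0 t1].
rewrite (_ : _ + _ = (1 - tau) *: x + tau *: y); last first.
  by rewrite scalerBr scalerBl scale1r addrAC addrA.
apply: le_trans (ler_normD _ _) _; rewrite !normrZ !ger0_norm ?subr_ge0//.
apply: (@le_trans _ _ ((1 - tau) * M + tau * M)); last by lra.
by rewrite lerD// ler_wpM2l// subr_ge0.
Qed.

Lemma norm_le_mxvec m n (A : 'M[R]_(m, n)) : `|A| <= `|mxvec A|.
Proof.
by apply: mx_norm_le => // i j; rewrite -mxvecE coord_le_norm.
Qed.

Lemma lipschitz_on_ball m (g : 'rV[R]_d -> 'rV[R]_m) (M : R) :
  (forall z, differentiable g z) ->
  continuous (fun z => mxvec (jacobian g z)) ->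
  exists2 L : R, 0 <= L & forall x y, `|x| <= M -> `|y| <= M ->
    `|g y - g x| <= L * `|y - x|.
Proof.
move=> dg cJ.
have cK : compact [set z : 'rV[R]_d | `|z| <= M].
  apply: bounded_closed_compact; first by exists M; split => [|r Mr z /= zM]; rewrite ?num_real// (le_trans zM)// ltW.
  apply: (preimage_closed _ (@closed_le _ M)) => z _.
  exact: norm_continuous.
have [B0 [_ HB0]] := compact_bounded (continuous_compact
  (continuous_subspaceT cJ) cK).
pose B := `|B0| + 1; have B0B : B0 < B by have := ler_norm B0; rewrite /B; lra.
have HB := HB0 _ B0B.
exists (d%:R * `|B|); first by rewrite mulr_ge0.
move=> x y xM yM.
have := @mean_value_le m g x y 0 `|B| dg (normr_ge0 _).
rewrite mulmx0 subr0 mulrA mulrAC; apply => tau t01.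
rewrite subr0; apply: le_trans (norm_le_mxvec _) _.
apply: le_trans (ler_norm B); apply: HB.
by exists (x + tau *: (y - x)) => //=; exact: segment_norm_le.
Qed.

Lemma locally_holder_continuous m (gamma : R) (g : 'rV[R]_d -> 'rV[R]_m) :
  0 < gamma -> locally_holder gamma g -> continuous g.
Proof.
move=> gam0 Hg x; have [L HL] := Hg x.
apply: (@cvgrPdist_le R 'rV[R]_m _ (nbhs x) _ g (g x)).2 => eps e0.
pose K : R := `|L| + 1; have K0 : 0 < K by rewrite ltr_wpDl.
pose N : R := (1 * d)%:R + 1; have N0 : 0 < N by rewrite ltr_wpDl.
have r0 : 0 < (eps / K) `^ gamma^-1 / N.
  by rewrite divr_gt0// powR_gt0// divr_gt0.
have near2 : \forall y \near x, enorm (g x - g y) <= L * enorm (x - y) `^ gamma.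
  have [[A B] /= [xA xB] AB] := HL.
  apply: filterS xB => y By; apply: (AB (x, y)); split => //=.
  exact: nbhs_singleton.
have near1 : \forall y \near x, `|x - y| < (eps / K) `^ gamma^-1 / N.
  by apply/nbhs_ballP; exists ((eps / K) `^ gamma^-1 / N) => // y; rewrite -ball_normE.
apply: filterS2 near1 near2 => y h1 h2; apply: le_trans (norm_le_enorm _) _.
apply: le_trans h2 _.
have h3 : enorm (x - y) <= (eps / K) `^ gamma^-1.
  apply: le_trans (enorm_le_norm _) _.
  apply: (@le_trans _ _ (N * `|x - y|)); first by rewrite ler_wpM2r// lerDl.
  by move: h1; rewrite ltr_pdivlMr// mulrC => /ltW.
have h4 : enorm (x - y) `^ gamma <= eps / K.
  apply: le_trans (ler_powR_nneg (ltW gam0) (enorm_ge0 _) h3) _.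
  by rewrite -powRrM mulVf ?gt_eqF// powRr1// divr_ge0// ltW.
apply: (@le_trans _ _ (K * (eps / K))); last by rewrite mulrC divfK// gt_eqF.
apply: (@le_trans _ _ (K * enorm (x - y) `^ gamma)).
  by rewrite ler_wpM2r ?powR_ge0// (le_trans (ler_norm _))// lerDl.
by rewrite ler_wpM2l// ltW.
Qed.

Lemma holder_Ck_continuous k m (gamma : R) (g : 'rV[R]_d -> 'rV[R]_m) :
  0 < gamma -> holder_Ck k gamma g -> continuous g.
Proof.
move=> gam0; case: k => [|k] /=; first exact: locally_holder_continuous.
by case=> dg _ x; apply: differentiable_continuous.
Qed.

(** An exponent above 2 forces at least two derivatives, since the Holder part
    is at most 1. *)
Lemma class_C_C2 m (a : R) (g : 'rV[R]_d -> 'rV[R]_m) : 2 < a -> class_C a g ->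
  let Dg := fun z => mxvec (jacobian g z) in
  [/\ forall z, differentiable g z, forall z, differentiable Dg z &
      continuous (fun z => mxvec (jacobian Dg z))].
Proof.
move=> a2 [k [gamma [gam0 gam1 aE]]].
case: k aE => [|[|k]] aE; [lra|lra|].
by move=> /= [dg [dDg /(holder_Ck_continuous gam0)]].
Qed.

Lemma C2_on_ball m (a M : R) (g : 'rV[R]_d -> 'rV[R]_m) : 2 < a -> class_C a g ->
  exists2 L : R, 0 <= L & forall x y, `|x| <= M -> `|y| <= M ->
    [/\ `|g y - g x| <= L * `|y - x|,
        `|Dmx g y - Dmx g x| <= L * `|y - x| &
        `|g y - g x - (y - x) *m (Dmx g x)^T| <= L * `|y - x| ^+ 2].
Proof.
move=> a2 Cg; have [dg dDg cD2g] := class_C_C2 a2 Cg.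
have cDg : continuous (fun z => mxvec (jacobian g z)).
  by move=> z; exact: differentiable_continuous.
have [L1 L10 H1] := @lipschitz_on_ball m g M dg cDg.
have [L2 L20 H2] := lipschitz_on_ball M dDg cD2g.
have {}H2 x y : `|x| <= M -> `|y| <= M ->
    `|jacobian g y - jacobian g x| <= L2 * `|y - x|.
  move=> xM yM; apply: le_trans (H2 x y xM yM).
  by apply: le_trans (norm_le_mxvec _) _; rewrite linearB.
exists (L1 + L2 + d%:R * L2); first by rewrite !addr_ge0// mulr_ge0.
move=> x y xM yM; have n0 := normr_ge0 (y - x).
have dL2 : 0 <= d%:R * L2 by rewrite mulr_ge0.
split.
- apply: le_trans (H1 x y xM yM) _; rewrite ler_wpM2r//; lra.
- apply: (@le_trans _ _ (L2 * `|y - x|)); last by rewrite ler_wpM2r//; lra.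
  apply: le_trans (H2 x y xM yM).
  apply: mx_norm_le => // i j; rewrite /Dmx.
  have := coord_le_norm (jacobian g y - jacobian g x) j i.
  by rewrite !mxE.
- rewrite /Dmx trmxK.
  apply: le_trans (mean_value_le (B := L2 * `|y - x|) dg _ _) _.
  + by rewrite mulr_ge0.
  + move=> tau t01; apply: le_trans (H2 _ _ xM (segment_norm_le xM yM t01)) _.
    rewrite [x + _]addrC addrK normrZ ler_wpM2l//.
    case/andP: t01 => t0 t1; rewrite ger0_norm// -[leRHS]mul1r ler_wpM2r//.
  + have E (u : R) : d%:R * (u * (L2 * u)) = d%:R * L2 * u ^+ 2 by ring.
    rewrite E.
    by rewrite ler_wpM2r ?sqr_ge0// lerDr addr_ge0.
Qed.

End Calculus.

(** * Partition points near a given time *)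

Section CutSums.
Context {R : realType}.
Implicit Types (s t T : R) (P : seq R).

Lemma partition_cell T P t : itv_partition 0 T P -> 0 < t -> t <= T ->
  exists l, [/\ (l < size P)%N, pt 0 P l < t & t <= pt 0 P l.+1].
Proof.
move=> TP t0 tT; pose A l := (l <= size P)%N && (pt 0 P l < t).
have exA : exists l, A l by exists 0%N; rewrite /A leq0n pt0.
have ubA l : A l -> (l <= size P)%N by case/andP.
case: (ex_maxnP exA ubA) => l /andP[lP lt] lmax.
have lP' : (l < size P)%N.
  rewrite ltn_neqAle lP andbT; apply/eqP => lE.
  by move: lt; rewrite lE (pt_size TP) ltNge tT.
exists l; split => //; rewrite leNgt; apply/negP => tl.
by have := lmax l.+1; rewrite /A lP' tl ltnn => /(_ isT).
Qed.

Lemma grid_point_right T P s : itv_partition 0 T P -> 0 <= s -> s <= T ->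
  exists k, [/\ (k <= size P)%N, s <= pt 0 P k & pt 0 P k <= s + mesh 0 P].
Proof.
move=> TP; rewrite le_eqVlt => /predU1P[<- _|s0 sT].
  by exists 0%N; rewrite pt0 add0r mesh_ge0.
have [l [lP ls sl]] := partition_cell TP s0 sT.
by exists l.+1; split => //; have := mesh_step 0 lP; lra.
Qed.

Lemma grid_point_left T P t : itv_partition 0 T P -> 0 <= t -> t <= T ->
  exists k, [/\ (k <= size P)%N, pt 0 P k <= t & t - mesh 0 P <= pt 0 P k].
Proof.
move=> TP; rewrite le_eqVlt => /predU1P[<- _|t0 tT].
  by exists 0%N; rewrite pt0 sub0r oppr_le0 mesh_ge0.
have [l [lP lt tl]] := partition_cell TP t0 tT.
exists l; split; [exact: ltnW|exact: ltW|].
by have := mesh_step 0 lP; lra.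
Qed.

(** Stopping the partition points at [t] kills the cells beyond [t] and
    shortens the cell that contains [t]. *)
Lemma sum_min_cut (V : zmodType) T P t l (g : nat -> R -> R -> V) :
  itv_partition 0 T P -> (l < size P)%N -> pt 0 P l <= t -> t <= pt 0 P l.+1 ->
  (forall k x, g k x x = 0) ->
  \sum_(k < size P) g k (Num.min (pt 0 P k) t) (Num.min (pt 0 P k.+1) t) =
  \sum_(k < l) g k (pt 0 P k) (pt 0 P k.+1) + g l (pt 0 P l) t.
Proof.
move=> TP lP lt tl g0.
pose G k := g k (Num.min (pt 0 P k) t) (Num.min (pt 0 P k.+1) t).
have tail0 : \sum_(l.+1 <= k < size P) G k = 0.
  rewrite big_nat_cond big1// => k /andP[/andP[lk kP] _].
  have tk : t <= pt 0 P k.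
    by apply: le_trans tl _; apply: (pt_leq TP) => //; exact: ltnW.
  have kk1 : pt 0 P k <= pt 0 P k.+1 by apply: (pt_leq TP).
  by rewrite /G !min_r// (le_trans tk).
rewrite -(big_mkord xpredT G).
rewrite (big_cat_nat (leq0n l) (ltnW lP)) (big_ltn lP) /= tail0 addr0 big_mkord /G.
congr (_ + _); last by rewrite min_l// min_r.
apply: eq_bigr => k _.
have kt : pt 0 P k.+1 <= t.
  by apply: le_trans lt; apply: (pt_leq TP) => //; exact: ltnW.
have kk1 : pt 0 P k <= pt 0 P k.+1.
  by apply: (pt_leq TP) => //; rewrite (leq_trans _ (ltnW lP)).
by rewrite !min_l// (le_trans kk1).
Qed.

End CutSums.

(** * Consequences of Property (RIE) *)

Lemma subrBB (V : zmodType) (a b c e : V) :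
  (a - b) - (c - e) = (a - c) - (b - e).
Proof. by rewrite !opprD !opprK addrACA. Qed.

(** Transfers a bound on a discretised area at partition points [u], [v] to the
    limit area at arbitrary times [s], [t]. *)
Lemma area_perturbation (R : realType) (d : nat) (J I : R -> 'M[R]_d)
    (S : R -> 'rV[R]_d) (s t u v eta M : R) :
  `|J u - J s| <= eta -> `|J t - J v| <= eta ->
  `|S u - S s| <= eta -> `|S t - S v| <= eta ->
  `|J u - I u| <= eta -> `|J v - I v| <= eta ->
  `|S s| <= M -> `|S t| <= M -> `|S u| <= M ->
  `|incr J s t - tensor (S s) (incr S s t)| <=
    `|incr I u v - tensor (S u) (incr S u v)| + (4 + 4 * M) * eta.
Proof.
move=> B1 B2 B3 B4 B5 B6 Ms Mt Mu.
have C1 : `|tensor (S u - S s) (incr S s t)| <= eta * (M + M).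
  apply: le_trans (tensor_le _ _) _; apply: ler_pM => //.
  by apply: le_trans (ler_normB _ _) _; exact: lerD.
have C2 : `|tensor (S u) (incr S s t - incr S u v)| <= M * (eta + eta).
  apply: le_trans (tensor_le _ _) _; apply: ler_pM => //.
  rewrite (_ : incr S s t - _ = (S t - S v) + (S u - S s)).
    by apply: le_trans (ler_normD _ _) _; exact: lerD.
  by rewrite /incr subrBB opprB.
rewrite (_ : incr J s t - _ = (incr I u v - tensor (S u) (incr S u v))
    + (J u - J s) + (J t - J v) - (J u - I u)
    + (J v - I v) + tensor (S u - S s) (incr S s t)
    - tensor (S u) (incr S s t - incr S u v)); last first.
  by apply/matrixP => i j; rewrite /incr /tensor !mxE !big_ord1 !mxE; ring.
rewrite (_ : _ + (4 + 4 * M) * eta = `|incr I u v - tensor (S u) (incr S u v)|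
  + eta + eta + eta + eta + eta * (M + M) + M * (eta + eta)); last by ring.
apply: le_trans (ler_normB _ _) _; apply: lerD => //.
do 2!(apply: le_trans (ler_normD _ _) _; apply: lerD => //).
apply: le_trans (ler_normB _ _) _; apply: lerD => //.
by do 2!(apply: le_trans (ler_normD _ _) _; apply: lerD => //).
Qed.

Section RIEBounds.
Context {R : realType}.
Implicit Types (s t eps : R).

Lemma equot_ge0 (x y : R) : 0 <= x -> 0 <= y -> (0 <= equot x y)%E.
Proof.
by move=> x0 y0; rewrite /equot mule_ge0 ?lee_fin// inve_ge0 lee_fin.
Qed.

(** The value [+oo] of [x / 0] for [x > 0] forces [x = 0] when [y = 0]. *)
Lemma equot_le1 (x y : R) : 0 <= x -> 0 <= y -> (equot x y <= 1)%E -> x <= y.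
Proof.
move=> x0 y0; rewrite /equot inver; case: eqP => [->|/eqP yn0].
  move: x0; rewrite le_eqVlt => /predU1P[->//|x0].
  by rewrite gt0_muley ?lte_fin.
by rewrite -EFinM lee_fin ler_pdivrMr ?mul1r// lt_neqAle eq_sym yn0.
Qed.

Variables (d : nat) (T p : R) (P : nat -> seq R) (S : R -> 'rV[R]_d).
Hypotheses (T_gt0 : 0 < T) (p_gt0 : 0 < p).
Hypothesis P_part : forall n, itv_partition 0 T (P n).

Lemma RIE_control : RIE T p P S -> exists2 c, control T c &
  (forall s t, 0 <= s -> s <= t -> t <= T ->
     enorm (incr S s t) <= c s t `^ p^-1) /\
  (forall n k l, (k < l)%N -> (l <= size (P n))%N ->
     let s := pt 0 (P n) k in let t := pt 0 (P n) l in
     enorm (incr (RIE_sum P S n) s t - tensor (S s) (incr S s t))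
       <= c s t `^ (2 / p)).
Proof.
move=> [_ [c [cc bnd]]]; exists c => //.
have [c0 _] := cc.
have path_elt s t : 0 <= s -> s <= t -> t <= T ->
    (equot (enorm (incr S s t) `^ p) (c s t) <= RIE_path_bound T p S c)%E.
  by move=> s0 st tT; apply: ereal_sup_ubound; exists (s, t).
have area_elt n k l : (k < l)%N -> (l <= size (P n))%N ->
    (equot (enorm (incr (RIE_sum P S n) (pt 0 (P n) k) (pt 0 (P n) l)
       - tensor (S (pt 0 (P n) k)) (incr S (pt 0 (P n) k) (pt 0 (P n) l))) `^ (p / 2))
       (c (pt 0 (P n) k) (pt 0 (P n) l)) <= RIE_area_bound p P S c)%E.
  move=> kl lP; apply: le_trans; last first.
    by apply: ereal_sup_ubound; exists n.
  by apply: ereal_sup_ubound; exists (k, l).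
have cgrid n k l : (k < l)%N -> (l <= size (P n))%N ->
    0 <= c (pt 0 (P n) k) (pt 0 (P n) l).
  move=> kl lP; apply: c0.
  - by case: (pt_bounds (P_part n) (leq_trans (ltnW kl) lP)).
  - by apply: (pt_leq (P_part n)) => //; exact: ltnW.
  - by case: (pt_bounds (P_part n) lP).
have path0 : (0 <= RIE_path_bound T p S c)%E.
  apply: le_trans (path_elt 0 0 _ _ _); rewrite ?lexx ?(ltW T_gt0)//.
  by rewrite equot_ge0 ?powR_ge0// c0 ?lexx// ltW.
have area0 : (0 <= RIE_area_bound p P S c)%E.
  have P0 : (0 < size (P 0%N))%N.
    rewrite lt0n; apply/eqP => /size0nil P0.
    have := P_part 0%N; rewrite P0 => /itv_partition_nil T0.
    by move: T_gt0; rewrite -T0 ltxx.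
  apply: le_trans (area_elt 0%N 0%N 1%N isT P0).
  by rewrite equot_ge0 ?powR_ge0// cgrid.
split=> [s t s0 st tT|n k l kl lP /=].
  apply: powR_root_le => //; first exact: enorm_ge0.
  apply: equot_le1; rewrite ?powR_ge0// ?c0//.
  apply: le_trans (path_elt s t s0 st tT) _.
  by apply: le_trans bnd; rewrite leeDl.
have -> : 2 / p = (p / 2)^-1 by rewrite invf_div.
apply: powR_root_le; [by rewrite divr_gt0|exact: enorm_ge0|].
apply: equot_le1; rewrite ?powR_ge0// ?cgrid//.
apply: le_trans (area_elt n k l kl lP) _.
by apply: le_trans bnd; rewrite leeDr.
Qed.

Lemma RIE_integral_uniform : RIE T p P S ->
  forall eps, 0 < eps -> \forall n \near \oo, forall t, 0 <= t -> t <= T ->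
     `|RIE_integral P S t - RIE_sum P S n t| < eps.
Proof.
move=> [[I /uniform_itvP HI] _].
have JI t : 0 <= t -> t <= T -> RIE_integral P S t = I t.
  move=> t0 tT; apply/cvg_lim => //.
  apply: (@cvgrPdist_lt R 'M[R]_d nat \oo _ (fun n => RIE_sum P S n t) (I t)).2.
  by move=> eps /HI; apply: filterS => n /(_ t t0 tT).
move=> eps /HI; apply: filterS => n Hn t t0 tT; rewrite JI//; exact: Hn.
Qed.

Hypothesis S_cont : {within `[0, T], continuous S}.

Lemma min_dist (a s t : R) : `|Num.min a t - Num.min a s| <= `|t - s|.
Proof.
rewrite !minEle; case: ifP => at_; case: ifP => as_; rewrite ?subrr ?normr0//.
- move/negbT: as_; rewrite -ltNge => as_; rewrite !ger0_norm//; lra.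
- move/negbT: at_; rewrite -ltNge => at_; rewrite distrC (distrC t) !ger0_norm//; lra.
Qed.

(** The integrand is a step function, so the sum is a finite combination of
    stopped copies of [S]. *)
Lemma RIE_sum_unif_continuous n (eps : R) : 0 < eps ->
  exists2 delta : R, 0 < delta & forall s t, 0 <= s -> s <= T -> 0 <= t -> t <= T ->
    `|t - s| <= delta -> `|RIE_sum P S n t - RIE_sum P S n s| <= eps.
Proof.
move=> e0; have [M M0 HM] := bounded_itv S_cont.
pose K : R := (size (P n))%:R * (M * 2) + 1.
have K1 : 1 <= K by rewrite lerDr !mulr_ge0.
have K0 : 0 < K by exact: lt_le_trans K1.
have [|delta d0 H] := uniformly_continuous_itv S_cont (eps := eps / K).
  by rewrite divr_gt0.
exists delta => // s t s0 sT t0 tT ts.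
have mineq k r : (k <= size (P n))%N -> 0 <= r -> r <= T ->
    0 <= Num.min (pt 0 (P n) k) r /\ Num.min (pt 0 (P n) k) r <= T.
  move=> kP r0 rT; have [? ?] := pt_bounds (P_part n) kP.
  by rewrite le_min r0 ge_min rT orbT; split => //; rewrite andbT.
have Hk k : (k <= size (P n))%N ->
    `|S (Num.min (pt 0 (P n) k) t) - S (Num.min (pt 0 (P n) k) s)| <= eps / K.
  move=> kP; have [? ?] := mineq k s kP s0 sT; have [? ?] := mineq k t kP t0 tT.
  by apply: H => //; apply: le_trans ts; exact: min_dist.
rewrite /RIE_sum -sumrB; apply: le_trans (ler_norm_sum _ _ _) _.
apply: (@le_trans _ _ (\sum_(k < size (P n)) M * (2 * (eps / K)))).
  apply: ler_sum => k _; rewrite /tensor -mulmxBr.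
  apply: le_trans (tensor_le _ _) _; apply: ler_pM => //.
    have [? ?] := pt_bounds (P_part n) (ltnW (ltn_ord k)); exact: HM.
  rewrite /incr subrBB.
  apply: le_trans (ler_normB _ _) _.
  rewrite mulr2n mulrDl mul1r lerD//; first exact: Hk.
  by apply: Hk; exact: ltnW.
rewrite sumr_const card_ord -[leLHS]mulr_natl.
rewrite (_ : _ * _ = ((size (P n))%:R * (M * 2)) / K * eps); last by ring.
rewrite -[leRHS]mul1r ler_wpM2r ?(ltW e0)// ler_pdivrMr// mul1r /K; lra.
Qed.

Hypothesis S_RIE : RIE T p P S.
Let J := RIE_integral P S.

Lemma RIE_integral_unif_continuous (eps : R) : 0 < eps ->
  exists2 delta : R, 0 < delta & forall s t, 0 <= s -> s <= T -> 0 <= t -> t <= T ->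
    `|t - s| <= delta -> `|J t - J s| <= eps.
Proof.
move=> e0; have e3 : 0 < eps / 3 by rewrite divr_gt0.
have [n Hn] := filter_ex (RIE_integral_uniform S_RIE e3).
have [delta d0 H] := RIE_sum_unif_continuous n e3.
exists delta => // s t s0 sT t0 tT ts.
have h1 := Hn t t0 tT; have h2 := Hn s s0 sT; have h3 := H s t s0 sT t0 tT ts.
rewrite -/J in h1 h2.
have := ler_distD (RIE_sum P S n t) (J t) (J s).
have := ler_distD (RIE_sum P S n s) (RIE_sum P S n t) (J s).
rewrite (distrC (RIE_sum P S n s) (J s)); lra.
Qed.

Lemma RIE_area_unif_small (eps : R) : 0 < eps ->
  exists2 delta : R, 0 < delta & forall s t, 0 <= s -> s <= t -> t <= T ->
    t - s <= delta -> `|RIE_area P S s t| <= eps.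
Proof.
move=> e0; have [M M0 HM] := bounded_itv S_cont.
have e2 : 0 < eps / 2 by rewrite divr_gt0.
have M1 : 0 < M + 1 by lra.
have [d1 d10 H1] := RIE_integral_unif_continuous e2.
have [|d2 d20 H2] := uniformly_continuous_itv S_cont (eps := eps / 2 / (M + 1)).
  by rewrite !divr_gt0.
exists (Num.min d1 d2); first by rewrite lt_min d10.
move=> s t s0 st tT; rewrite le_min => /andP[ts1 ts2].
have n0 : `|t - s| = t - s by rewrite ger0_norm// subr_ge0.
apply: le_trans (ler_normB _ _) _.
have -> : eps = eps / 2 + eps / 2 by lra.
apply: lerD; first by apply: H1; rewrite ?n0//; lra.
apply: le_trans (tensor_le _ _) _.
apply: (@le_trans _ _ ((M + 1) * (eps / 2 / (M + 1)))).
  apply: ler_pM => //; first by rewrite (le_trans (HM s s0 _)); lra.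
  by apply: H2; rewrite ?n0//; lra.
by rewrite mulrC divfK// gt_eqF.
Qed.

Hypothesis P_mesh : mesh 0 (P n) @[n --> \oo] --> (0 : R).

(** Choose partition points [u <= v] inside [s, t] close to its ends.  The
    postulated bound at [u, v] passes to the limit because [c u v <= c s t],
    although [c u v] itself may fail to converge. *)
Lemma RIE_area_le (c : R -> R -> R) : control T c ->
  (forall n k l, (k < l)%N -> (l <= size (P n))%N ->
     let s := pt 0 (P n) k in let t := pt 0 (P n) l in
     enorm (incr (RIE_sum P S n) s t - tensor (S s) (incr S s t))
       <= c s t `^ (2 / p)) ->
  forall s t, 0 <= s -> s <= t -> t <= T -> `|RIE_area P S s t| <= c s t `^ (2 / p).
Proof.
move=> [c0 cD] Hc s t s0; rewrite le_eqVlt => /predU1P[<- _|st tT].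
  rewrite /RIE_area /incr !subrr /tensor mulmx0 subrr normr0; exact: powR_ge0.
have [M M0 HM] := bounded_itv S_cont.
have M4 : 0 < 4 + 4 * M by lra.
apply/ler_addgt0Pr => eps e0; pose eta := eps / (4 + 4 * M).
have eta0 : 0 < eta by rewrite divr_gt0.
have [d1 d10 H1] := RIE_integral_unif_continuous eta0.
have [d2 d20 H2] := uniformly_continuous_itv S_cont eta0.
have [n [Hn [mn1 mn2 mn3]]] : exists n,
    (forall t, 0 <= t -> t <= T -> `|J t - RIE_sum P S n t| < eta) /\
    [/\ mesh 0 (P n) < d1, mesh 0 (P n) < d2 & mesh 0 (P n) < (t - s) / 2].
  have m0 : 0 < Num.min (Num.min d1 d2) ((t - s) / 2).
    by rewrite !lt_min d10 d20 divr_gt0// subr_gt0.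
  have nm : \forall n \near \oo, `|0 - mesh 0 (P n)| < Num.min (Num.min d1 d2) ((t - s) / 2).
    by move/cvgrPdist_lt : P_mesh; exact.
  have [n [h1 h2]] := filter_ex (filterI (RIE_integral_uniform S_RIE eta0) nm).
  exists n; split => //; move: h2; rewrite sub0r normrN ger0_norm ?mesh_ge0//.
  by rewrite !lt_min => /andP[/andP[]].
have [sT t0] : s <= T /\ 0 <= t by split; lra.
have [k [kP sk ks]] := grid_point_right (P_part n) s0 sT.
have [l [lP lt tl]] := grid_point_left (P_part n) t0 tT.
have kl : (k < l)%N.
  rewrite ltnNge; apply/negP => lk.
  have := le_trans tl (le_trans (pt_leq (P_part n) lk kP) ks); lra.
have := Hc n k l kl lP; have := pt_ltn (P_part n) kl lP.
move: (pt 0 (P n) k) (pt 0 (P n) l) sk ks lt tl => u v sk ks vt tv uv /= A1.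
have [u0 uT] : 0 <= u /\ u <= T by split; lra.
have [v0 vT] : 0 <= v /\ v <= T by split; lra.
have [us tv'] : `|u - s| <= mesh 0 (P n) /\ `|t - v| <= mesh 0 (P n).
  by rewrite !ger0_norm ?subr_ge0//; split; lra.
have cuv : c u v <= c s t.
  have := cD s u t s0 sk (le_trans (ltW uv) vt) tT.
  have := cD u v t u0 (ltW uv) vt tT.
  have := c0 s u s0 sk uT; have := c0 v t v0 vt tT.
  by clear; move: (c _ _) (c _ _) (c _ _) (c _ _) (c _ _) => *; lra.
have {}A1 : `|incr (RIE_sum P S n) u v - tensor (S u) (incr S u v)| <= c s t `^ (2 / p).
  apply: le_trans (norm_le_enorm _) _; apply: le_trans A1 _.
  apply: ler_powR_nneg cuv; first by rewrite divr_ge0// ltW.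
  exact: c0 u0 (ltW uv) vT.
have us1 := le_trans us (ltW mn1); have us2 := le_trans us (ltW mn2).
have vt1 := le_trans tv' (ltW mn1); have vt2 := le_trans tv' (ltW mn2).
have := area_perturbation (H1 s u s0 sT u0 uT us1) (H1 v t v0 vT t0 tT vt1)
  (H2 s u s0 sT u0 uT us2) (H2 v t v0 vT t0 tT vt2)
  (ltW (Hn u u0 uT)) (ltW (Hn v v0 vT)) (HM s s0 sT) (HM t t0 tT) (HM u u0 uT).
move/le_trans; apply; apply: lerD => //.
by rewrite /eta mulrC divfK// gt_eqF.
Qed.

Lemma RIE_area_chen : chen S (RIE_area P S).
Proof.
move=> s u t; apply/matrixP => i j; rewrite /RIE_area /incr /tensor !mxE !big_ord1 !mxE.
ring.
Qed.

(** On a cell the discrete integral [int S^n dS] grows exactly by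
    [S_(t_l)] tensor [S_(t_l, v)], the term that is subtracted in the area. *)
Lemma RIE_area_cell n l v : (l < size (P n))%N -> pt 0 (P n) l <= v ->
  v <= pt 0 (P n) l.+1 ->
  RIE_area P S (pt 0 (P n) l) v = incr (fun t => J t - RIE_sum P S n t) (pt 0 (P n) l) v.
Proof.
move=> lP lv vl.
pose g k x y := tensor (S (pt 0 (P n) k)) (incr S x y).
have g0 k x : g k x x = 0 by rewrite /g /incr subrr /tensor mulmx0.
have E t : pt 0 (P n) l <= t -> t <= pt 0 (P n) l.+1 ->
    RIE_sum P S n t = \sum_(k < l) g k (pt 0 (P n) k) (pt 0 (P n) k.+1) + g l (pt 0 (P n) l) t.
  by move=> lt tl; exact: (sum_min_cut (P_part n) lP lt tl g0).
have ll1 : pt 0 (P n) l <= pt 0 (P n) l.+1 by exact: le_trans vl.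
rewrite /RIE_area /incr (E v)// (E _ (lexx _) ll1) g0 addr0 -/J /g /incr.
by apply/matrixP => i j; rewrite !mxE; ring.
Qed.

End RIEBounds.

(** * Partitions stopped at a given time *)

Section TruncatedPartition.
Context {R : realType}.
Implicit Types (t T : R) (P : seq R).

Definition cut_partition P l t := rcons (take l P) t.

Lemma size_cut P l t : (l < size P)%N -> size (cut_partition P l t) = l.+1.
Proof. by move=> lP; rewrite size_rcons size_take lP. Qed.

Lemma pt_cut P l t k : (l < size P)%N -> (k <= l)%N ->
  pt 0 (cut_partition P l t) k = pt 0 P k.
Proof.
move=> lP kl; rewrite /pt /cut_partition.
rewrite (_ : 0 :: rcons (take l P) t = rcons (take l.+1 (0 :: P)) t)//.
by rewrite nth_rcons (@size_takel l.+1) ?ltnS// ?kl ?nth_take// ltnW.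
Qed.

Lemma pt_cut_last P l t : (l < size P)%N -> pt 0 (cut_partition P l t) l.+1 = t.
Proof.
move=> lP; rewrite /pt /cut_partition /= nth_rcons size_take lP ltnn eqxx.
by [].
Qed.

Lemma cut_partitionP T P l t : itv_partition 0 T P -> (l < size P)%N ->
  pt 0 P l < t -> itv_partition 0 t (cut_partition P l t).
Proof.
move=> TP lP lt; split; last by rewrite last_rcons.
rewrite rcons_path; apply/andP; split.
  have [+ _] := TP; rewrite -{1}(cat_take_drop l P) cat_path.
  by case/andP.
suff -> : last 0 (take l P) = pt 0 P l by [].
rewrite (last_nth 0) size_take lP /pt.
rewrite (_ : 0 :: take l P = take l.+1 (0 :: P))// nth_take//.
Qed.

Lemma psum_cut Xi P l t : (l < size P)%N ->
  psum Xi 0 (cut_partition P l t) =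
  \sum_(k < l) Xi (pt 0 P k) (pt 0 P k.+1) + Xi (pt 0 P l) t.
Proof.
move=> lP; rewrite /psum size_cut// big_ord_recr /= pt_cut_last// pt_cut//.
congr (_ + _); apply: eq_bigr => k _.
by rewrite !pt_cut// ltnW.
Qed.

Lemma mesh_cut P l t : (l < size P)%N -> t <= pt 0 P l.+1 ->
  mesh 0 (cut_partition P l t) <= mesh 0 P.
Proof.
move=> lP tl; apply: mesh_le => [|k]; first exact: mesh_ge0.
rewrite size_cut// ltnS leq_eqVlt => /predU1P[->|kl].
  rewrite pt_cut_last// pt_cut//.
  by apply: le_trans (mesh_step 0 lP); rewrite lerB.
rewrite !pt_cut ?(ltnW kl)//; apply: mesh_step; exact: ltn_trans lP.
Qed.

End TruncatedPartition.

(** * Defects and discrete Young sums under a common control *)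

Section Estimates.
Context {R : realType} {d : nat}.
Implicit Types (s t u v e rho eps delta : R).
Variables (T alpha beta C : R) (w : R -> R -> R).
Hypotheses (w_control : control T w) (al0 : 0 < alpha) (be0 : 0 < beta) (C0 : 0 <= C).
Hypothesis th1 : 1 < alpha + alpha + beta.

Let th := alpha + alpha + beta.

Lemma powR_split (x : R) : x `^ th = x `^ alpha * x `^ alpha * x `^ beta.
Proof.
have a2 : 0 < alpha + alpha by rewrite addr_gt0.
have a3 : 0 < alpha + alpha + beta by rewrite addr_gt0.
by rewrite /th powRD ?(gt_eqF a3)// powRD ?(gt_eqF a2).
Qed.

Lemma control_mono (s u v t : R) : 0 <= s -> s <= u -> u <= v -> v <= t -> t <= T ->
  w u v <= w s t.
Proof.
have [w0 wD] := w_control; move=> s0 su uv vt tT.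
have ut := le_trans uv vt.
have := wD s u t s0 su ut tT.
have := wD u v t (le_trans s0 su) uv vt tT.
have := w0 s u s0 su (le_trans ut tT).
have := w0 v t (le_trans (le_trans s0 su) uv) vt tT; lra.
Qed.

Lemma powR_control_mono (s u v t e : R) : 0 <= e -> 0 <= s -> s <= u -> u <= v ->
  v <= t -> t <= T -> w u v `^ e <= w s t `^ e.
Proof.
move=> e0 s0 su uv vt tT; apply: ler_powR_nneg => //.
  by apply: w_control.1 => //; [exact: le_trans su|exact: le_trans tT].
exact: control_mono.
Qed.

(** The assumption on [rho] encodes the uniform continuity of the rough path,
    already interpolated with its control. *)
Lemma germ_defect_small (S : R -> 'rV[R]_d) (SS : R -> R -> 'M[R]_d)
    (Y F : R -> 'rV[R]_d) (Y' F' : R -> 'M[R]_d) :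
  chen S SS ->
  (forall t, 0 <= t -> t <= T -> `|Y' t| <= C) ->
  (forall t, 0 <= t -> t <= T -> `|F' t| <= C) ->
  (forall s t, 0 <= s -> s <= t -> t <= T ->
    [/\ `|incr S s t| <= C * w s t `^ alpha,
        `|incr F s t| <= C * `|incr S s t|,
        `|remainder S Y Y' s t| <= C * w s t `^ (alpha + beta) &
        `|remainder S F F' s t| <= C * w s t `^ (alpha + beta)]) ->
  (forall s t, 0 <= s -> s <= t -> t <= T ->
    `|incr Y' s t| <= C * w s t `^ beta /\ `|incr F' s t| <= C * w s t `^ beta) ->
  (forall rho, 0 < rho -> exists2 delta : R, 0 < delta &
    forall s t, 0 <= s -> s <= t -> t <= T -> t - s <= delta ->
      `|incr S s t| <= rho * w s t `^ alpha /\
      `|SS s t| <= rho * w s t `^ (alpha + alpha)) ->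
  forall eps, 0 < eps -> exists2 delta : R, 0 < delta &
    forall s u t, 0 <= s -> s <= u -> u <= t -> t <= T -> t - s <= delta ->
      `|defect (germ SS Y Y' F F') s u t| <= eps * w s t `^ th.
Proof.
move=> chenS Y'C F'C H1 H2 small eps eps0.
pose K : R := d%:R * C ^+ 2 + d%:R ^+ 2 * C ^+ 2 + d%:R ^+ 3 * C ^+ 3
  + 2 * (d%:R ^+ 3 * C ^+ 2).
have K0 : 0 <= K by rewrite !addr_ge0// !mulr_ge0// exprn_ge0.
have K1 : 0 < K + 1 by rewrite ltr_wpDl.
have rho0 : 0 < eps / (K + 1) by rewrite divr_gt0.
have [delta d0 Hd] := small _ rho0.
exists delta => // s u t s0 su ut tT ts.
have st := le_trans su ut; have u0 := le_trans s0 su; have uT := le_trans ut tT.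
have sT := le_trans st tT.
have us : u - s <= delta by apply: le_trans ts; rewrite lerB.
have tu : t - u <= delta by apply: le_trans ts; rewrite lerB.
have [S1 F1 R1 _] := H1 s u s0 su uT; have [S2 F2 _ R2] := H1 u t u0 ut tT.
have [Y1 G1] := H2 s u s0 su uT.
have [S3 _] := Hd s u s0 su uT us; have [S4 A4] := Hd u t u0 ut tT tu.
have al0' := ltW al0; have be0' := ltW be0.
have ab0 : 0 <= alpha + beta by rewrite addr_ge0.
have aa0 : 0 <= alpha + alpha by rewrite addr_ge0.
have absplit x : x `^ (alpha + beta) = x `^ alpha * x `^ beta :> R.
  by rewrite powRD// gt_eqF// addr_gt0.
have aasplit x : x `^ (alpha + alpha) = x `^ alpha * x `^ alpha :> R.
  by rewrite powRD// gt_eqF// addr_gt0.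
have msu e : 0 <= e -> w s u `^ e <= w s t `^ e by move=> e0; exact: powR_control_mono.
have mut e : 0 <= e -> w u t `^ e <= w s t `^ e by move=> e0; exact: powR_control_mono.
have rho0' := ltW rho0.
apply: le_trans (germ_defect_le (C := C) (rho := eps / (K + 1))
  (a := w s t `^ alpha) (b := w s t `^ beta) chenS C0 rho0'
  (powR_ge0 _ _) (powR_ge0 _ _) (Y'C s s0 sT) (F'C u u0 uT) _ _ _ _ _ _ _ _) _.
- by apply: le_trans R1 _; rewrite -absplit ler_wpM2l// msu.
- apply: le_trans F2 _; rewrite ler_wpM2l//; apply: le_trans S4 _.
  by rewrite ler_wpM2l// mut.
- by apply: le_trans S3 _; rewrite ler_wpM2l// msu.
- by apply: le_trans S2 _; rewrite ler_wpM2l// mut.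
- by apply: le_trans R2 _; rewrite -absplit ler_wpM2l// mut.
- by apply: le_trans Y1 _; rewrite ler_wpM2l// msu.
- by apply: le_trans G1 _; rewrite ler_wpM2l// msu.
- by apply: le_trans A4 _; rewrite -aasplit ler_wpM2l// mut.
rewrite -/K powR_split ler_wpM2r ?mulr_ge0 ?powR_ge0//.
rewrite mulrCA -[leRHS]mulr1 ler_wpM2l ?(ltW eps0)// ler_pdivrMr// mul1r.
by rewrite lerDl.
Qed.

(** Discrete Young estimate for the germ [A_s B_s D_(s,t)], whose defect only
    involves increments of [A] and [B] over [s, u] and of [D] over [u, t]. *)
Lemma young_sum_le (A B D : R -> 'M[R]_d) (rho : R) P l :
  itv_partition 0 T P -> 0 <= rho ->
  (forall t, 0 <= t -> t <= T -> `|A t| <= C /\ `|B t| <= C) ->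
  (forall s t, 0 <= s -> s <= t -> t <= T ->
    `|incr A s t| <= C * w s t `^ beta /\ `|incr B s t| <= C * w s t `^ beta) ->
  (forall i j, (i <= j)%N -> (j <= size P)%N ->
    `|incr D (pt 0 P i) (pt 0 P j)| <=
      rho * w (pt 0 P i) (pt 0 P j) `^ (alpha + alpha)) ->
  (l <= size P)%N ->
  `|\sum_(k < l) contract (A (pt 0 P k)) (B (pt 0 P k))
       (incr D (pt 0 P k) (pt 0 P k.+1))|
    <= rho * (sewing_const th * (2 * (d%:R ^+ 3 * C ^+ 2) * w 0 T `^ th)
       + d%:R ^+ 3 * C ^+ 2 * w 0 T `^ (alpha + alpha)).
Proof.
move=> TP rho0 ABC incAB incD lP.
pose Xi i j := contract (A (pt 0 P i)) (B (pt 0 P i)) (incr D (pt 0 P i) (pt 0 P j)).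
pose K : R := d%:R ^+ 3 * C ^+ 2.
have K0 : 0 <= K by rewrite mulr_ge0// exprn_ge0.
have ptb i : (i <= size P)%N -> 0 <= pt 0 P i /\ pt 0 P i <= T.
  exact: (pt_bounds TP).
have ptm i j : (i <= j)%N -> (j <= size P)%N -> pt 0 P i <= pt 0 P j.
  exact: (pt_leq TP).
have aa0 : 0 <= alpha + alpha by rewrite addr_ge0// ltW.
have T0 : 0 <= T by exact: itv_partition_le TP.
have dXi i j k : (i <= j)%N -> (j <= k <= size P)%N ->
    `|Xi i k - Xi i j - Xi j k| <= 2 * K * rho * w (pt 0 P i) (pt 0 P k) `^ th.
  move=> ij /andP[jk kP].
  have jP := leq_trans jk kP; have iP := leq_trans ij jP.
  have [i0 iT] := ptb i iP; have [j0 jT] := ptb j jP; have [k0 kT] := ptb k kP.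
  have tij := ptm i j ij jP; have tjk := ptm j k jk kP.
  have Djk := incD j k jk kP.
  rewrite /Xi; move: (pt 0 P i) (pt 0 P j) (pt 0 P k) i0 iT j0 jT k0 kT tij tjk Djk.
  move=> s u t s0 sT u0 uT t0 tT su ut Dut.
  have [As Bs] := ABC s s0 sT; have [Au Bu] := ABC u u0 uT.
  have [iA iB] := incAB s u s0 su uT.
  have E : contract (A s) (B s) (incr D s t) - contract (A s) (B s) (incr D s u)
     - contract (A u) (B u) (incr D u t) =
     - (contract (incr A s u) (B u) (incr D u t) + contract (A s) (incr B s u) (incr D u t)).
    rewrite (incrD D s u t) contractDr (incr_eq A s u) (incr_eq B s u).
    by rewrite !(contractDl, contractDm); ring.
  rewrite E normrN; apply: le_trans (ler_normD _ _) _.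
  have be0' := ltW be0.
  have mb : w s u `^ beta <= w s t `^ beta by apply: powR_control_mono.
  have ma : w u t `^ (alpha + alpha) <= w s t `^ (alpha + alpha) by apply: powR_control_mono.
  have {}iA : `|incr A s u| <= C * w s t `^ beta by apply: le_trans iA _; rewrite ler_wpM2l.
  have {}iB : `|incr B s u| <= C * w s t `^ beta by apply: le_trans iB _; rewrite ler_wpM2l.
  have {}Dut : `|incr D u t| <= rho * w s t `^ (alpha + alpha).
    by apply: le_trans Dut _; rewrite ler_wpM2l.
  have T1 : `|contract (incr A s u) (B u) (incr D u t)| <=
      d%:R ^+ 3 * (C * w s t `^ beta * C * (rho * w s t `^ (alpha + alpha))).
    apply: le_trans (contract_le _ _ _) _.
    by rewrite ler_wpM2l ?exprn_ge0// ler_pM ?mulr_ge0// ler_pM.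
  have T2 : `|contract (A s) (incr B s u) (incr D u t)| <=
      d%:R ^+ 3 * (C * (C * w s t `^ beta) * (rho * w s t `^ (alpha + alpha))).
    apply: le_trans (contract_le _ _ _) _.
    by rewrite ler_wpM2l ?exprn_ge0// ler_pM ?mulr_ge0// ler_pM.
  apply: le_trans (lerD T1 T2) _; rewrite le_eqVlt; apply/orP; left; apply/eqP.
  have -> : w s t `^ th = w s t `^ (alpha + alpha) * w s t `^ beta.
    by rewrite -powRD// gt_eqF// !addr_gt0.
  by rewrite /K; move: (w s t `^ _) (w s t `^ _) => a b; ring.
have := @discrete_sewing R th (2 * K * rho) (size P)
  (fun i j => w (pt 0 P i) (pt 0 P j)) Xi th1 _ _ _ dXi 0%N l.
rewrite leq0n lP big_mkord pt0.
have [l0 lT] := ptb l lP.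
have [w0 wD] := w_control.
have th0 : 0 <= th by rewrite ltW// (lt_trans _ th1).
move=> /(_ _ _ _ isT) H.
have {}H : `|\sum_(i < l) Xi i i.+1 - Xi 0%N l| <=
    sewing_const th * (2 * K * rho * w 0 T `^ th).
  apply: le_trans (H _ _ _) _.
  - by rewrite !mulr_ge0.
  - move=> i j /andP[ij jP]; have [i0 _] := ptb _ (leq_trans ij jP).
    by have [_ jT] := ptb _ jP; apply: w0 => //; exact: ptm.
  - move=> i j k ij /andP[jk kP]; have jP := leq_trans jk kP.
    have [i0 _] := ptb _ (leq_trans ij jP); have [_ kT] := ptb _ kP.
    by apply: wD => //; exact: ptm.
  - rewrite ler_wpM2l ?(le_trans _ (sewing_const_ge2 th1))//.
    rewrite ler_wpM2l ?mulr_ge0//; apply: powR_control_mono => //.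
have X0 : `|Xi 0%N l| <= K * rho * w 0 T `^ (alpha + alpha).
  have [A0 B0] := ABC 0 (lexx _) T0.
  have D0 : `|incr D (pt 0 P 0) (pt 0 P l)| <= rho * w 0 T `^ (alpha + alpha).
    apply: le_trans (incD 0%N l (leq0n _) lP) _; rewrite ler_wpM2l// pt0.
    exact: powR_control_mono.
  apply: le_trans (contract_le _ _ _) _.
  apply: (@le_trans _ _ (d%:R ^+ 3 * (C * C * (rho * w 0 T `^ (alpha + alpha))))).
    by rewrite ler_wpM2l ?exprn_ge0// ler_pM ?mulr_ge0// ler_pM.
  rewrite le_eqVlt; apply/orP; left; apply/eqP; rewrite /K.
  by move: (w 0 T `^ _) => a; ring.
rewrite (_ : \sum_(k < l) _ = (\sum_(i < l) Xi i i.+1 - Xi 0%N l) + Xi 0%N l); last by rewrite subrK.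
apply: le_trans (ler_normD _ _) _; apply: le_trans (lerD H X0) _.
by rewrite le_eqVlt; apply/orP; left; apply/eqP; rewrite -/K; ring.
Qed.

End Estimates.

(** * Variation of dominated paths *)

Section Composition.
Context {R : realType}.
Implicit Types (T a e K L s t : R) (w : R -> R -> R).

Lemma dominated_continuous (V W : normedModType R) T L (X : R -> V) (Z : R -> W) :
  {within `[0, T], continuous X} ->
  (forall s t, 0 <= s -> s <= T -> 0 <= t -> t <= T ->
     `|Z t - Z s| <= L * `|X t - X s|) ->
  {within `[0, T], continuous Z}.
Proof.
move=> cX H; apply/within_itvP => t t0 tT; apply/cvgrPdist_le => eps e0.
have K0 : 0 < `|L| + 1 by rewrite ltr_wpDl.
have ek0 : 0 < eps / (`|L| + 1) by rewrite divr_gt0.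
have := (within_itvP T X).1 cX t t0 tT => /cvgrPdist_le /(_ _ ek0).
rewrite !near_withinE; apply: filterS => s Hs s0T.
have := s0T; rewrite /= in_itv /= => /andP[s0 sT].
apply: le_trans (H s t s0 sT t0 tT) _.
apply: (@le_trans _ _ ((`|L| + 1) * (eps / (`|L| + 1)))); last first.
  by rewrite mulrC divfK// gt_eqF.
apply: (@le_trans _ _ ((`|L| + 1) * `|X t - X s|)).
  by rewrite ler_wpM2r// (le_trans (ler_norm _))// lerDl.
by rewrite ler_wpM2l ?(ltW K0)//; exact: Hs.
Qed.

Lemma pvar_lty_powR T w m n (A : R -> R -> 'M[R]_(m, n)) a e K :
  control T w -> 0 <= T -> 0 <= K -> 0 < a -> 1 <= e * a ->
  (forall s t, 0 <= s -> s <= t -> t <= T -> `|A s t| <= K * w s t `^ e) ->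
  (pvar a A 0 T < +oo)%E.
Proof.
move=> cw T0 K0 a0 ea1 H; have [w0 wD] := cw.
pose N : R := (m * n)%:R; have N0 : 0 <= N by [].
apply: (@pvar_lty R T w m n A a ((N * K) `^ a * w 0 T `^ (e * a - 1))) => //.
  by rewrite mulr_ge0 ?powR_ge0.
move=> s t s0 st tT; have wst := w0 s t s0 st tT.
have le1 : enorm (A s t) <= N * K * w s t `^ e.
  by apply: le_trans (enorm_le_norm _) _; rewrite -mulrA ler_wpM2l// H.
apply: le_trans (ler_powR_nneg (ltW a0) (enorm_ge0 _) le1) _.
rewrite powRM ?powR_ge0 ?mulr_ge0// -powRrM -mulrA ler_wpM2l ?powR_ge0//.
have := @powR_exp_lower R (w s t) (w 0 T) (e * a) 1 wst.
rewrite powRr1//; apply => //.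
exact (control_le0T cw s0 st tT).
Qed.

End Composition.

(** * Left-point Riemann sums and the rough integral *)

Section RiemannSums.
Context {R : realType}.
Implicit Types (s t : R).

Lemma le_sum_seq (ks : seq R) (k : R) : (forall x, x \in ks -> 0 <= x) ->
  k \in ks -> k <= \sum_(x <- ks) x.
Proof.
move=> ks0 kks; rewrite (big_rem k)//= lerDl big_seq; apply: sumr_ge0 => x.
by move=> /mem_rem /ks0.
Qed.

(** [kap] is half of the excess of [2 / p + 1 / q] over 1.  Since [2 / p < 1],
    multiplying [2 / p] by [1 - kap] costs less than this excess. *)
Lemma exponent_bounds (p q : R) : 2 < p -> p <= q -> 1 < 2 / p + 1 / q ->
  let kap := (2 / p + 1 / q - 1) / 2 in let alpha := (1 - kap) * p^-1 in
  [/\ 0 < kap < 1, 0 < alpha <= p^-1, 0 < q^-1 <= p^-1 &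
      1 < alpha + alpha + q^-1].
Proof.
move=> p2 pq; rewrite div1r => pq1 kap alpha.
have p0 : 0 < p by lra.
have q0 : 0 < q by lra.
have ip0 : 0 < p^-1 by rewrite invr_gt0.
have iq0 : 0 < q^-1 by rewrite invr_gt0.
have ipq : q^-1 <= p^-1 by rewrite lef_pV2.
have ip2 : p^-1 < 2^-1 by rewrite ltf_pV2// posrE.
have k0 : 0 < kap by rewrite /kap; lra.
have k1 : kap < 1 by rewrite /kap; lra.
split; rewrite ?k0 ?iq0//.
- rewrite /alpha mulr_gt0 ?subr_gt0//= -[leRHS]mul1r ler_wpM2r ?(ltW ip0)//; lra.
- have : kap * (2 / p) < kap * 1 by rewrite ltr_pM2l//; lra.
  rewrite /alpha mulr1 => h; rewrite mulrBl mul1r; move: h; rewrite mulrA (mulrC kap) -mulrA.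
  move: (kap * p^-1) => kp h; rewrite /kap in h; lra.
Qed.

Variables (d : nat) (T p q : R) (P : nat -> seq R) (S : R -> 'rV[R]_d).
Variable f : 'rV[R]_d -> 'rV[R]_d.
Hypotheses (T_gt0 : 0 < T) (p_gt2 : 2 < p).
Hypothesis S_cont : {within `[0, T], continuous S}.
Hypotheses (q_ge_p : p <= q) (pq_gt1 : 1 < 2 / p + 1 / q).

Let fS := fun t => f (S t).
Let DfS := fun t => Dmx f (S t).

Variable L : R.
Hypothesis L0 : 0 <= L.
Hypothesis f_S : forall s t, 0 <= s -> s <= T -> 0 <= t -> t <= T ->
  [/\ `|incr fS s t| <= L * `|incr S s t|, `|incr DfS s t| <= L * `|incr S s t| &
      `|remainder S fS DfS s t| <= L * `|incr S s t| ^+ 2].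

Variable c : R -> R -> R.
Hypothesis c_control : control T c.
Hypothesis c_S : forall s t, 0 <= s -> s <= t -> t <= T ->
  `|incr S s t| <= c s t `^ p^-1.

Let p0 : 0 < p. Proof. by apply: lt_trans p_gt2. Qed.
Let q0 : 0 < q. Proof. exact: lt_le_trans q_ge_p. Qed.

Lemma sqr_powR_inv (x : R) : (x `^ p^-1) ^+ 2 = x `^ (2 / p).
Proof. by rewrite -powR_mulrn ?powR_ge0// -powRrM mulrC. Qed.

(** [Df(S)] varies like [S], and [p <= q]; the remainder is of second order in
    the increments of [S], and [1 / p + 1 / q <= 2 / p]. *)
Lemma composition_controlled : controlled T p q S fS DfS.
Proof.
have T0 := ltW T_gt0.
have [_ _ /andP[iq0 iqp] _] := exponent_bounds p_gt2 q_ge_p pq_gt1.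
have ip0 : 0 < p^-1 by rewrite invr_gt0.
have r0 : 0 < (p^-1 + q^-1)^-1 by rewrite invr_gt0 addr_gt0.
split.
- by apply: (dominated_continuous S_cont (L := L)) => s t s0 sT t0 tT; case: (f_S s0 sT t0 tT).
- by apply: (dominated_continuous S_cont (L := L)) => s t s0 sT t0 tT; case: (f_S s0 sT t0 tT).
- apply: (pvar_lty_powR c_control T0 L0 q0 (e := p^-1)).
    by rewrite mulrC ler_pdivlMr// mul1r.
  move=> s t s0 st tT.
  have [_ h _] := f_S s0 (le_trans st tT) (le_trans s0 st) tT.
  by apply: le_trans h _; rewrite ler_wpM2l// c_S.
- apply: (pvar_lty_powR c_control T0 L0 r0 (e := 2 / p)).
    by rewrite ler_pdivlMr ?addr_gt0// mul1r; lra.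
  move=> s t s0 st tT.
  have [_ _ h] := f_S s0 (le_trans st tT) (le_trans s0 st) tT.
  apply: le_trans h _; rewrite ler_wpM2l// -sqr_powR_inv.
  by rewrite lerXn2r ?nnegrE ?powR_ge0// c_S.
Qed.

Hypothesis P_part : forall n, itv_partition 0 T (P n).
Hypothesis P_mesh : mesh 0 (P n) @[n --> \oo] --> (0 : R).
Hypothesis S_RIE : RIE T p P S.
Hypothesis c_area : forall n k l, (k < l)%N -> (l <= size (P n))%N ->
  let s := pt 0 (P n) k in let t := pt 0 (P n) l in
  enorm (incr (RIE_sum P S n) s t - tensor (S s) (incr S s t)) <= c s t `^ (2 / p).

Variables (Y : R -> 'rV[R]_d) (Y' : R -> 'M[R]_d).
Hypothesis Y_controlled : controlled T p q S Y Y'.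

Let kap := (2 / p + 1 / q - 1) / 2.
Let alpha := (1 - kap) * p^-1.
Let beta := q^-1.
Let SS := RIE_area P S.

(** The control is the sum of [c] and of the controls of [Y'] and of the
    remainder of [Y]; exponents are lowered to [alpha], [beta] and
    [alpha + beta] at the price of powers of [w 0 T]. *)
Lemma common_control : exists w C, [/\ control T w, 0 <= C,
  forall s t, 0 <= s -> s <= t -> t <= T -> c s t <= w s t,
  forall t, 0 <= t -> t <= T -> `|Y' t| <= C /\ `|DfS t| <= C &
  forall s t, 0 <= s -> s <= t -> t <= T ->
    [/\ `|incr S s t| <= C * w s t `^ alpha,
        `|incr fS s t| <= C * `|incr S s t|,
        `|remainder S Y Y' s t| <= C * w s t `^ (alpha + beta) &
        `|remainder S fS DfS s t| <= C * w s t `^ (alpha + beta)] /\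
    (`|incr Y' s t| <= C * w s t `^ beta /\ `|incr DfS s t| <= C * w s t `^ beta)].
Proof.
have T0 := ltW T_gt0.
have [/andP[k0 k1] /andP[al0 alp] /andP[be0 bep] th1] :=
  exponent_bounds p_gt2 q_ge_p pq_gt1.
rewrite -/kap -/alpha -/beta in k0 k1 al0 alp be0 bep th1.
have ip0 : 0 < p^-1 by rewrite invr_gt0.
have r0 : 0 < (p^-1 + q^-1)^-1 by rewrite invr_gt0 addr_gt0.
have [cY cY' vY' vR] := Y_controlled.
have [|w1 w1c Hw1] := pvar_control q0 T0 _ vY'; first by move=> s; rewrite /incr subrr.
have [|w2 w2c Hw2] := pvar_control r0 T0 _ vR.
  by move=> s; rewrite /remainder /incr !subrr mul0mx subrr.
rewrite invrK in Hw2.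
pose w s t := c s t + (w1 s t + w2 s t).
have wc : control T w by apply: controlD => //; exact: controlD.
have [c0 _] := c_control; have [w10 _] := w1c; have [w20 _] := w2c; have [w0 _] := wc.
have cw s t : 0 <= s -> s <= t -> t <= T -> c s t <= w s t.
  by move=> s0 st tT; rewrite /w lerDl addr_ge0 ?w10 ?w20.
have w1w s t : 0 <= s -> s <= t -> t <= T -> w1 s t <= w s t.
  by move=> s0 st tT; rewrite /w addrCA lerDl addr_ge0 ?c0 ?w20.
have w2w s t : 0 <= s -> s <= t -> t <= T -> w2 s t <= w s t.
  by move=> s0 st tT; rewrite /w addrA lerDr addr_ge0 ?c0 ?w10.
have lower a b : 0 < b -> b <= a -> exists2 k, 0 <= k &
    forall s t, 0 <= s -> s <= t -> t <= T -> w s t `^ a <= k * w s t `^ b.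
  move=> b0 ba; exists (w 0 T `^ (a - b)); first exact: powR_ge0.
  move=> s t s0 st tT; apply: powR_exp_lower => //; first exact: w0.
  exact (control_le0T wc s0 st tT).
have Sw s t : 0 <= s -> s <= t -> t <= T -> `|incr S s t| <= w s t `^ p^-1.
  move=> s0 st tT; apply: le_trans (c_S s0 st tT) _.
  by apply: ler_powR_nneg; [exact: ltW|exact: c0|exact: cw].
have [k1' k10 Hk1] := lower _ _ al0 alp.
have [|k2 k20 Hk2] := lower (p^-1 + q^-1) (alpha + beta) (addr_gt0 al0 be0).
  by rewrite lerD.
have [|k3 k30 Hk3] := lower (2 / p) (alpha + beta) (addr_gt0 al0 be0).
  by rewrite mulr_natl mulr2n lerD.
have [k4 k40 Hk4] := lower _ _ be0 bep.
have [M1 M10 HM1] := bounded_itv cY'.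
have [_ cDf _ _] := composition_controlled.
have [M2 M20 HM2] := bounded_itv cDf.
pose ks := [:: k1'; k2; L * k3; L * k4; M1; M2; L; 1].
have ks0 k : k \in ks -> 0 <= k.
  by move: k; apply/allP; rewrite /= k10 k20 !mulr_ge0// M10 M20 L0 ler01.
pose C := \sum_(k <- ks) k.
have kC k : k \in ks -> k <= C by exact: le_sum_seq.
have C0 : 0 <= C by apply: le_trans ler01 (kC 1 _); rewrite !inE eqxx !orbT.
have [C1 C2 C3] : [/\ k1' <= C, k2 <= C & L * k3 <= C].
  by split; apply: kC; rewrite !inE eqxx ?orbT.
have [C4 C5 C6 [C7 C8]] : [/\ L * k4 <= C, M1 <= C, M2 <= C & (L <= C /\ 1 <= C)].
  by do ?split; apply: kC; rewrite !inE eqxx ?orbT.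
move: C kC C0 C1 C2 C3 C4 C5 C6 C7 C8 => C _ C0 C1 C2 C3 C4 C5 C6 C7 C8.
exists w, C; split => //.
  move=> t t0 tT; split; first exact: le_trans (HM1 t t0 tT) C5.
  exact: le_trans (HM2 t t0 tT) C6.
move=> s t s0 st tT; have sT := le_trans st tT; have t0 := le_trans s0 st.
have [F1 F2 F3] := f_S s0 sT t0 tT.
have Swst := Sw s t s0 st tT.
split; first split.
- apply: le_trans Swst _; apply: le_trans (Hk1 s t s0 st tT) _.
  by rewrite ler_wpM2r ?powR_ge0.
- by apply: le_trans F1 _; rewrite ler_wpM2r.
- apply: le_trans (norm_le_enorm _) _; apply: le_trans (Hw2 s t s0 st tT) _.
  apply: (@le_trans _ _ (w s t `^ (p^-1 + q^-1))).
    by apply: ler_powR_nneg; [exact/ltW/addr_gt0|exact: w20|exact: w2w].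
  by apply: le_trans (Hk2 s t s0 st tT) _; rewrite ler_wpM2r ?powR_ge0.
- apply: le_trans F3 _.
  apply: (@le_trans _ _ (L * w s t `^ (2 / p))).
    by rewrite ler_wpM2l// -sqr_powR_inv lerXn2r ?nnegrE ?powR_ge0.
  apply: (@le_trans _ _ (L * k3 * w s t `^ (alpha + beta))).
    by rewrite -mulrA ler_wpM2l// Hk3.
  by rewrite ler_wpM2r ?powR_ge0.
- split.
    apply: le_trans (norm_le_enorm _) _; apply: le_trans (Hw1 s t s0 st tT) _.
    apply: (@le_trans _ _ (w s t `^ beta)).
      by apply: ler_powR_nneg; [exact: ltW|exact: w10|exact: w1w].
    by rewrite -[leLHS]mul1r ler_wpM2r ?powR_ge0.
  apply: le_trans F2 _; apply: (@le_trans _ _ (L * w s t `^ p^-1)).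
    by rewrite ler_wpM2l.
  apply: (@le_trans _ _ (L * k4 * w s t `^ beta)).
    by rewrite -mulrA ler_wpM2l// Hk4.
  by rewrite ler_wpM2r ?powR_ge0.
Qed.

Lemma rough_path_small (w : R -> R -> R) (rho : R) : control T w ->
  (forall s t, 0 <= s -> s <= t -> t <= T -> c s t <= w s t) -> 0 < rho ->
  exists2 delta : R, 0 < delta & forall s t, 0 <= s -> s <= t -> t <= T ->
    t - s <= delta -> `|incr S s t| <= rho * w s t `^ alpha /\
      `|SS s t| <= rho * w s t `^ (alpha + alpha).
Proof.
move=> [w0 _] cw rho0.
have [/andP[k0 k1] _ _ _] := exponent_bounds p_gt2 q_ge_p pq_gt1.
have eta0 : 0 < rho `^ kap^-1 by rewrite powR_gt0.
have etaE : (rho `^ kap^-1) `^ kap = rho.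
  by rewrite -powRrM mulVf ?gt_eqF// powRr1// ltW.
have [d1 d10 H1] := uniformly_continuous_itv S_cont eta0.
have [d2 d20 H2] := RIE_area_unif_small P_part S_cont S_RIE eta0.
have c_SS := RIE_area_le p0 P_part S_cont S_RIE P_mesh c_control c_area.
have ip0 : 0 < p^-1 by rewrite invr_gt0.
have ip2 : 0 < 2 / p by rewrite divr_gt0.
exists (Num.min d1 d2); first by rewrite lt_min d10.
move=> s t s0 st tT; rewrite le_min => /andP[ts1 ts2].
have [c0 _] := c_control; have cst := cw s t s0 st tT; have c0st := c0 s t s0 st tT.
have sT := le_trans st tT; have t0 := le_trans s0 st.
rewrite -etaE; split.
  apply: interpolate => //; first by apply: H1 => //; rewrite ger0_norm// subr_ge0.
  by apply: le_trans (c_S s0 st tT) _; apply: ler_powR_nneg => //; exact: ltW.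
have -> : alpha + alpha = (1 - kap) * (2 / p) by rewrite /alpha; ring.
apply: interpolate => //; first exact: H2.
by apply: le_trans (c_SS s t s0 st tT) _; apply: ler_powR_nneg => //; exact: ltW.
Qed.

Let D n t := RIE_integral P S t - RIE_sum P S n t.

(** Between partition points the increment of [D n] is the difference of the
    areas of the rough path and of its n-th discretisation, which are both
    bounded by [c ^ (2 / p)]; interpolate with the uniform bound [eta]. *)
Lemma discretisation_error_le (w : R -> R -> R) n (eta : R) : control T w ->
  (forall s t, 0 <= s -> s <= t -> t <= T -> c s t <= w s t) ->
  (forall t, 0 <= t -> t <= T -> `|D n t| <= eta) ->
  forall i j, (i <= j)%N -> (j <= size (P n))%N ->
    `|incr (D n) (pt 0 (P n) i) (pt 0 (P n) j)| <=
      2 * eta `^ kap * w (pt 0 (P n) i) (pt 0 (P n) j) `^ (alpha + alpha).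
Proof.
move=> [w0 _] cw Deta i j ij jP.
have [/andP[k0 k1] _ _ _] := exponent_bounds p_gt2 q_ge_p pq_gt1.
have ip2 : 0 < 2 / p by rewrite divr_gt0.
have [s0 sT] := pt_bounds (P_part n) (leq_trans ij jP).
have [t0 tT] := pt_bounds (P_part n) jP.
have st := pt_leq (P_part n) ij jP.
move: ij; rewrite leq_eqVlt => /predU1P[ijE|ij].
  rewrite ijE /incr subrr normr0 !mulr_ge0// ?powR_ge0//.
have c_SS := RIE_area_le p0 P_part S_cont S_RIE P_mesh c_control c_area s0 st tT.
have c_A := le_trans (norm_le_enorm _) (c_area ij jP).
have [c0 _] := c_control.
have cst := cw _ _ s0 st tT; have c0st := c0 _ _ s0 st tT.
have cpow : c (pt 0 (P n) i) (pt 0 (P n) j) `^ (2 / p) <=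
    w (pt 0 (P n) i) (pt 0 (P n) j) `^ (2 / p).
  by apply: ler_powR_nneg => //; exact: ltW.
rewrite -mulrA -ler_pdivrMl// -[2^-1]ger0_norm ?invr_ge0// -normrZ.
have -> : alpha + alpha = (1 - kap) * (2 / p) by rewrite /alpha; ring.
have h2 (x : R) : 2^-1 * (x + x) = x by lra.
apply: interpolate => //; rewrite normrZ ger0_norm ?invr_ge0//.
- rewrite -[leRHS]h2 ler_wpM2l ?invr_ge0//.
  by apply: le_trans (ler_normB _ _) _; rewrite lerD// Deta.
- rewrite -[leRHS]h2 ler_wpM2l ?invr_ge0//.
  have -> : incr (D n) (pt 0 (P n) i) (pt 0 (P n) j) =
      RIE_area P S (pt 0 (P n) i) (pt 0 (P n) j)
      - (incr (RIE_sum P S n) (pt 0 (P n) i) (pt 0 (P n) j)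
         - tensor (S (pt 0 (P n) i)) (incr S (pt 0 (P n) i) (pt 0 (P n) j))).
    by rewrite /RIE_area opprB addrA subrK /D /incr subrBB.
  apply: le_trans (ler_normB _ _) _; rewrite lerD//.
    exact: le_trans cpow.
  exact: le_trans cpow.
Qed.

Let Xi := germ SS Y Y' fS DfS.

(** Left-point sums stopped at [t] are compensated sums over the n-th partition
    stopped at [t], minus the second order terms; the former are close to the
    rough integral and the latter form a small Young sum. *)
Lemma rough_integral_riemann :
  (forall t, 0 <= t -> t <= T -> rough_integrable SS Y Y' fS DfS t) /\
  {uniform `[0, T],
      (fun t : R => \sum_(k < size (P n))
         dotp (Y (pt 0 (P n) k))
           (incr fS (Num.min (pt 0 (P n) k) t) (Num.min (pt 0 (P n) k.+1) t)))
      @[n --> \oo] --> rough_integral SS Y Y' fS DfS}.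
Proof.
have T0 := ltW T_gt0.
have [/andP[k0 k1] /andP[al0 _] /andP[be0 _] th1] :=
  exponent_bounds p_gt2 q_ge_p pq_gt1.
rewrite -/kap -/alpha -/beta in k0 k1 al0 be0 th1.
have [w [C [wc C0 cw bndC H]]] := common_control.
have small := @germ_defect_small R d T alpha beta C w wc al0 be0 C0 S SS Y fS Y' DfS
  (@RIE_area_chen R d P S)
  (fun t h0 hT => (bndC t h0 hT).1) (fun t h0 hT => (bndC t h0 hT).2)
  (fun s t h0 h hT => (H s t h0 h hT).1) (fun s t h0 h hT => (H s t h0 h hT).2)
  (fun rho => rough_path_small wc cw).
split; first by move=> t t0 tT; exact: (psum_cvg wc th1 small t0 tT).
apply/uniform_itvP => e e0.
have e4 : 0 < e / 4 by rewrite divr_gt0.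
have [delta delta0 Hdelta] := psum_lim_uniform wc th1 small e4.
pose K1 : R := d%:R ^+ 3 * C ^+ 2.
pose K := sewing_const (alpha + alpha + beta) * (2 * K1 * w 0 T `^ (alpha + alpha + beta))
       + K1 * w 0 T `^ (alpha + alpha).
have K10 : 0 <= K1 by rewrite mulr_ge0// exprn_ge0.
have K0 : 0 <= K.
  apply: addr_ge0; last by rewrite mulr_ge0 ?powR_ge0.
  apply: mulr_ge0; first by apply: le_trans (sewing_const_ge2 th1).
  by rewrite mulr_ge0 ?powR_ge0// mulr_ge0.
have K1' : 0 < K + 1 by rewrite ltr_wpDl.
have K11 : 0 < K1 + 1 by rewrite ltr_wpDl.
(* the first bound makes the Young sum small, the second one the last cell *)
pose eta := Num.min ((e / 4 / (2 * (K + 1))) `^ kap^-1) (e / 4 / (2 * (K1 + 1))).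
have eta0 : 0 < eta by rewrite lt_min powR_gt0 ?divr_gt0// mulr_gt0.
have etaK : 2 * eta `^ kap * K <= e / 4.
  have h : eta `^ kap <= e / 4 / (2 * (K + 1)).
    have X0 : 0 <= e / 4 / (2 * (K + 1)) by rewrite divr_ge0// ltW// mulr_gt0.
    have XE : e / 4 / (2 * (K + 1)) = ((e / 4 / (2 * (K + 1))) `^ kap^-1) `^ kap.
      by rewrite -powRrM mulVf ?gt_eqF// powRr1.
    rewrite XE; apply: ler_powR_nneg; rewrite ?(ltW eta0) ?(ltW k0)//.
    by rewrite ge_min lexx.
  apply: (@le_trans _ _ (2 * (e / 4 / (2 * (K + 1))) * (K + 1))).
    by rewrite ler_pM ?mulr_ge0 ?powR_ge0// ?ler_wpM2l// lerDl.
  by rewrite le_eqVlt; apply/orP; left; apply/eqP; field; rewrite gt_eqF.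
have etaK1 : K1 * (eta + eta) <= e / 4.
  have h : eta <= e / 4 / (2 * (K1 + 1)) by rewrite ge_min lexx orbT.
  apply: (@le_trans _ _ ((K1 + 1) * (e / 4 / (2 * (K1 + 1)) + e / 4 / (2 * (K1 + 1))))).
    by apply: ler_pM => //; [rewrite addr_ge0// ltW|rewrite lerDl|rewrite lerD].
  by rewrite le_eqVlt; apply/orP; left; apply/eqP; field; rewrite gt_eqF.
have mesh_small : \forall n \near \oo, `|0 - mesh 0 (P n)| < delta.
  by move/cvgrPdist_lt : P_mesh; exact.
have area_small := RIE_integral_uniform S_RIE eta0.
apply: filterS2 mesh_small area_small => n; rewrite sub0r normrN ger0_norm ?mesh_ge0//.
move=> mn Jn t; rewrite le_eqVlt => /predU1P[<- _|t0 tT].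
  have nil0 : itv_partition (0 : R) 0 [::] by split => /=.
  have := Hdelta 0 [::] T0 nil0; rewrite /mesh big_ord0 => /(_ delta0).
  rewrite psum_nil -/(rough_integral SS Y Y' fS DfS 0) => h.
  rewrite big1 => [|k _]; last first.
    have [pk _] := pt_bounds (P_part n) (ltnW (ltn_ord k)).
    have [pk1 _] := pt_bounds (P_part n) (ltn_ord k).
    by rewrite !min_r// /incr subrr dotp0r.
  by rewrite distrC; apply: le_lt_trans h _; lra.
have [l [lP lt tl]] := partition_cell (P_part n) t0 tT.
have tQ := cut_partitionP (P_part n) lP lt.
have mQ := le_lt_trans (mesh_cut lP tl) mn.
have := Hdelta t _ tT tQ mQ; rewrite -/(rough_integral SS Y Y' fS DfS t) => HQ.
rewrite (sum_min_cut (g := fun k x y => dotp (Y (pt 0 (P n) k)) (incr fS x y))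
  (P_part n) lP (ltW lt) tl); last by move=> k x; rewrite /incr subrr dotp0r.
rewrite psum_cut// in HQ.
have Jn' s : 0 <= s -> s <= T -> `|D n s| <= eta by move=> s0 sT; exact/ltW/Jn.
have [pl0 plT] := pt_bounds (P_part n) (ltnW lP).
have Young := young_sum_le wc al0 be0 C0 th1 (P_part n)
  (ltac:(by rewrite mulr_ge0 ?powR_ge0) : 0 <= 2 * eta `^ kap) bndC
  (fun s t h0 h hT => (H s t h0 h hT).2)
  (discretisation_error_le wc cw Jn') (ltnW lP).
rewrite -/K1 -/K in Young.
have cell : `|contract (Y' (pt 0 (P n) l)) (DfS (pt 0 (P n) l)) (incr (D n) (pt 0 (P n) l) t)|
    <= e / 4.
  have [b1 b2] := bndC _ pl0 plT.
  apply: le_trans (contract_le _ _ _) _; apply: le_trans etaK1.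
  have K1E : K1 * (eta + eta) = d%:R ^+ 3 * (C * C * (eta + eta)) by rewrite /K1; ring.
  rewrite K1E ler_wpM2l ?exprn_ge0// ler_pM ?mulr_ge0//; first by rewrite ler_pM.
  by apply: le_trans (ler_normB _ _) _; rewrite lerD// Jn'// ltW.
set A := \sum_(k < l) contract _ _ _ in Young.
set B := contract _ _ _ in cell.
set LS := \sum_(k < l) dotp _ _ + _.
have E : \sum_(k < l) germ SS Y Y' fS DfS (pt 0 (P n) k) (pt 0 (P n) k.+1) +
    germ SS Y Y' fS DfS (pt 0 (P n) l) t = LS + A + B.
  rewrite /germ big_split /= /LS /A /B -(RIE_area_cell S P_part lP (ltW lt) tl).
  rewrite [X in _ + X + _ = _](_ : _ = A); last first.
    apply: eq_bigr => k _; congr (contract _ _ _).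
    apply: (RIE_area_cell S P_part) => //; first exact: ltn_trans lP.
    by apply: (pt_leq (P_part n)) => //; exact: ltn_trans lP.
  by rewrite /A; ring.
rewrite E in HQ.
have {}Young := le_trans Young etaK.
(* A + B is the second order part and LS the left-point sum *)
have -> : rough_integral SS Y Y' fS DfS t - LS =
  A + B - (LS + A + B - rough_integral SS Y Y' fS DfS t) by ring.
apply: le_lt_trans (ler_normB _ _) _.
apply: le_lt_trans (lerD (ler_normD _ _) (lexx _)) _.
apply: le_lt_trans (lerD (lerD Young cell) HQ) _; lra.
Qed.

End RiemannSums.

Theorem theorem2p12 (R : realType) (d : nat) (T p q eps : R)
    (P : nat -> seq R) (S : R -> 'rV[R]_d) (f : 'rV[R]_d -> 'rV[R]_d)
    (T_gt0 : 0 < T) (p_gt2 : 2 < p) (p_lt3 : p < 3)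
    (P_part : forall n, itv_partition 0 T (P n))
    (P_mesh : mesh 0 (P n) @[n --> \oo] --> (0 : R))
    (S_cont : {within `[0, T], continuous S})
    (S_RIE : RIE T p P S)
    (q_ge_p : p <= q) (pq_gt1 : 1 < 2 / p + 1 / q)
    (eps_gt0 : 0 < eps) (f_reg : class_C (p + eps) f) :
  let fS := fun t => f (S t) in
  let DfS := fun t => Dmx f (S t) in
  controlled T p q S fS DfS /\
  forall (Y : R -> 'rV[R]_d) (Y' : R -> 'M[R]_d), controlled T p q S Y Y' ->
    (forall t, 0 <= t -> t <= T ->
       rough_integrable (RIE_area P S) Y Y' fS DfS t) /\
    {uniform `[0, T],
      (fun t : R => \sum_(k < size (P n))
         dotp (Y (pt 0 (P n) k))
           (incr fS (Num.min (pt 0 (P n) k) t) (Num.min (pt 0 (P n) k.+1) t)))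
      @[n --> \oo] --> rough_integral (RIE_area P S) Y Y' fS DfS}.
Proof.
move=> fS DfS.
have p_gt0 : 0 < p by apply: lt_trans p_gt2.
have [c c_control [c_S c_area]] := RIE_control T_gt0 p_gt0 P_part S_RIE.
have {}c_S (s t : R) : 0 <= s -> s <= t -> t <= T ->
    `|incr S s t| <= c s t `^ p^-1.
  by move=> s0 st tT; apply: le_trans (norm_le_enorm _) (c_S s t s0 st tT).
have [M _ S_bounded] := bounded_itv S_cont.
have pe_gt2 : 2 < p + eps by rewrite (lt_trans p_gt2)// ltrDl.
have [L L0 f_ball] := C2_on_ball M pe_gt2 f_reg.
have f_S (s t : R) : 0 <= s -> s <= T -> 0 <= t -> t <= T ->
    [/\ `|incr fS s t| <= L * `|incr S s t|,
        `|incr DfS s t| <= L * `|incr S s t| &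
        `|remainder S fS DfS s t| <= L * `|incr S s t| ^+ 2].
  by move=> s0 sT t0 tT; apply: f_ball; apply: S_bounded.
split=> [|Y Y' Y_controlled].
  exact (composition_controlled T_gt0 p_gt2 S_cont q_ge_p pq_gt1 L0 f_S
    c_control c_S).
exact (rough_integral_riemann T_gt0 p_gt2 S_cont q_ge_p pq_gt1 L0 f_S
  c_control c_S P_part P_mesh S_RIE c_area Y_controlled).
Qed.
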